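(* Let $U$ be a unitary with spectral gap $\Delta$ around a target eigenphase $\phi_0$, i.e. $|\phi_j-\phi_0|>\Delta$ for all $j\neq0$. Assume oracle access to a controlled version of $U$, and an initial state $|\psi\rangle$ such that $|\langle\phi_0|\psi\rangle|^2>\eta$. Further assume an initial estimate $\phi_{\mathrm{guess}}$ of $\phi_0$ such that $|\phi_0-\phi_{\mathrm{guess}}|<\Delta/3$. Then the noiseless Filtered Moment projection Phase Estimator (FMPE), with a Gaussian kernel and using $t$ calls to $U$ per circuit, produces an estimate $\tilde\phi$ of $\phi_0$ with RMS error up to $\epsilon$ using $M'=O(\eta^{-1}t^{-2}\epsilon^{-2})$ samples and $T=O(\eta^{-1}t^{-1}\epsilon^{-2})$ total calls to $U$, as long as $t=\Omega\big(\Delta^{-1}\log^{1/2}(\Delta\epsilon^{-1}\eta^{-1})\big)$ and $M'=\Omega(\eta^{-1})$.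
   Context: Setup. $U|\phi_j\rangle=e^{i\phi_j}|\phi_j\rangle$ with $\phi_j\in[0,2\pi)$; $a_j=|\langle\phi_j|\psi\rangle|^2$. Phases are assumed shifted by a constant if needed so that intervals below do not wrap around the circle. Sampling model. A (noiseless) phase estimation circuit using $t$ calls to controlled-$U$ and one copy of $|\psi\rangle$ returns a sample $x\in[0,2\pi)$ from $p(x)=\sum_ja_jf_\sigma(x-\phi_j)$, where $f_\sigma(x)\propto e^{-x^2/2\sigma^2}$ is the Gaussian kernel normalized on $(-\pi,\pi)$ and $\sigma=\Theta(t^{-1})$. (The finite precision $\epsilon_{\mathrm{synth}}$ of the Gaussian synthesis, which costs a factor $\sqrt{\log(\epsilon_{\mathrm{synth}}^{-1})}$ in depth, is ignored.) Filtering. Let $\mathcal D=[\phi_{\mathrm{guess}}-\Delta/2,\phi_{\mathrm{guess}}+\Delta/2]$. Samples outside $\mathcal D$ are discarded; the retained samples have density $P(x)=p(x)/\int_{\mathcal D}p(y)\,dy$ on $\mathcal D$. $M'$ is the (expected) number of circuit runs before filtering, $M$ the number of retained samples. FMPE (noiseless). $\tilde\phi=\operatorname{arg\,max}_\phi\frac1M\sum_j\log Q(x_j|\phi)$ over the retained samples, with model $Q(x|\phi)=f_\sigma(x-\phi)/\int_{\mathcal D}f_\sigma(y-\phi)\,dy$ on $\mathcal D$. RMS error means $\sqrt{\mathbb E[(\tilde\phi-\phi_0)^2]}$, evaluated in the large-sample regime (i.e. with the bias and variance given by their $M\to\infty$ asymptotics).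
   Formalization: The formal theorem adds that the target error satisfies ε ≤ κΔ for a fixed arbitrary κ < 1, with constants depending on κ; otherwise, as ε = Δ and η → 1, the logarithm vanishes, the condition on t is void and the claimed sample bound fails. *)

(* Defs.v *)
From HB Require Import structures.
From mathcomp Require Import all_boot all_order all_algebra.
From mathcomp Require Import spectral complex.
From mathcomp Require Import all_classical all_reals all_analysis.

Set Implicit Arguments.
Unset Strict Implicit.
Unset Printing Implicit Defensive.

Import Order.TTheory GRing.Theory Num.Theory.
Import numFieldNormedType.Exports.

Local Open Scope classical_set_scope.
Local Open Scope ring_scope.
Local Open Scope complex_scope.
Local Open Scope sesquilinear_scope.

Definition cis (R : realType) (theta : R) : R[i] := cos theta +i* sin theta.

Definition braket (R : realType) (n : nat) (u w : 'cV[R[i]]_n) : R[i] :=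
  (u ^t* *m w) 0 0.

Definition eigendecomposition (R : realType) (n : nat) (U : 'M[R[i]]_n)
    (v : 'I_n -> 'cV[R[i]]_n) (phi : 'I_n -> R) : Prop :=
  [/\ forall j k, braket (v j) (v k) = (j == k)%:R,
      forall j, U *m v j = cis (phi j) *: v j
    & forall j, 0 <= phi j < 2 * pi].

Definition overlap (R : realType) (n : nat) (v : 'I_n -> 'cV[R[i]]_n)
    (psi : 'cV[R[i]]_n) (j : 'I_n) : R := ComplexField.Normc.normc (braket (v j) psi) ^+ 2.

(* Representative in [-pi, pi[ of x modulo 2 pi: differences of phases are
   angles, so the kernel is extended 2 pi-periodically from ]-pi, pi[. *)
Definition principal_angle (R : realType) (x : R) : R :=
  x - 2 * pi * (Num.floor ((x + pi) / (2 * pi)))%:~R.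

Definition gaussian (R : realType) (sigma x : R) : R :=
  expR (- x ^+ 2 / (2 * sigma ^+ 2)).

Definition gauss_kernel (R : realType) (sigma x : R) : R :=
  gaussian sigma (principal_angle x) /
  \int[lebesgue_measure]_(y in `]- pi, pi[) gaussian sigma y.

Definition sample_density (R : realType) (n : nat) (a phi : 'I_n -> R)
    (sigma x : R) : R :=
  \sum_j a j * gauss_kernel sigma (x - phi j).

Definition window (R : realType) (guess Delta : R) : set R :=
  `[guess - Delta / 2, guess + Delta / 2].

Definition retained_fraction (R : realType) (n : nat) (a phi : 'I_n -> R)
    (sigma : R) (D : set R) : R :=
  \int[lebesgue_measure]_(y in D) sample_density a phi sigma y.

Definition filtered_density (R : realType) (n : nat) (a phi : 'I_n -> R)
    (sigma : R) (D : set R) (x : R) : R :=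
  sample_density a phi sigma x / retained_fraction a phi sigma D.

(* Expected number M' of circuit runs that yields M retained samples. *)
Definition expected_runs (R : realType) (n : nat) (a phi : 'I_n -> R)
    (sigma : R) (D : set R) (M : nat) : R :=
  M%:R / retained_fraction a phi sigma D.

Definition total_calls (R : realType) (n : nat) (a phi : 'I_n -> R)
    (sigma : R) (D : set R) (t M : nat) : R :=
  t%:R * expected_runs a phi sigma D M.

Definition has_density_on d (T : measurableType d) (R : realType)
    (Pr : probability T R) (X : {RV Pr >-> R}) (D : set R) (f : R -> R) : Prop :=
  forall A : set R, measurable A ->
    distribution Pr X A = (\int[lebesgue_measure]_(x in A `&` D) (f x)%:E)%E.

Definition mutually_independent d (T : measurableType d) (R : realType)
    (Pr : probability T R) (X : nat -> {RV Pr >-> R}) : Prop :=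
  forall (J : seq nat) (A : nat -> set R), uniq J ->
    (forall k, measurable (A k)) ->
    Pr (\big[setI/setT]_(k <- J) (X k @^-1` A k)) =
    (\prod_(k <- J) Pr (X k @^-1` A k))%E.

Definition fmpe_model (R : realType) (sigma : R) (D : set R) (x phi : R) : R :=
  gauss_kernel sigma (x - phi) /
  \int[lebesgue_measure]_(y in D) gauss_kernel sigma (y - phi).

Definition fmpe_objective (R : realType) (sigma : R) (D : set R) (M : nat)
    (x : nat -> R) (phi : R) : R :=
  M%:R^-1 * \sum_(k < M) ln (fmpe_model sigma D (x k) phi).

(* phit is a maximiser over all phases; ties are not broken. *)
Definition is_fmpe (R : realType) (sigma : R) (D : set R) (M : nat)
    (x : nat -> R) (phit : R) : Prop :=
  0 <= phit < 2 * pi /\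
  forall phi, 0 <= phi < 2 * pi ->
    fmpe_objective sigma D M x phi <= fmpe_objective sigma D M x phit.

(* The bias of est M tends to b, and its variance is V / M + o(1 / M). *)
Definition asymptotic_bias d (T : measurableType d) (R : realType)
    (Pr : probability T R) (est : nat -> {RV Pr >-> R}) (phi0 b : R) : Prop :=
  ('E_Pr[est M] - phi0%:E)%E @[M --> \oo] --> b%:E.

Definition asymptotic_variance d (T : measurableType d) (R : realType)
    (Pr : probability T R) (est : nat -> {RV Pr >-> R}) (V : R) : Prop :=
  (M%:R%:E * 'V_Pr[est M])%E @[M --> \oo] --> V%:E.

(* sqrt (E[(est M - phi0)^2]) = sqrt (bias^2 + variance), with the bias and the
   variance replaced by their asymptotic values b and V / M. *)
Definition large_sample_rms (R : realType) (b V : R) (M : nat) : R :=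
  Num.sqrt (b ^+ 2 + V / M%:R).

(* Main.v *)
(** On the window [D], which is shorter than half the circle, the model
    [Q(x | phi)] with [phi] in [D] is a truncated Gaussian, hence an exponential
    family with sufficient statistic [x]: its log-likelihood depends on the
    samples only through their mean, and is maximal exactly where the mean
    [mu(phi)] of [Q(. | phi)] equals the sample mean.  A phase outside [D] cannot
    be the maximiser as long as the samples have a small second moment around
    [phi0], since [phi0] itself then does better.  So, up to an event of
    probability [O(1 / M^2)] (a Chernoff bound), the estimate is [mu^-1] of the
    sample mean, and the delta method gives its limit [p] with [mu(p) = E x] and
    its variance [Var x / (M mu'(p)^2)], of order [sigma^2 / M].  The bias
    [p - phi0] is due to the other eigenphases, whose kernels reach [D] only by
    their tails, of size [expR (- Delta^2 / (72 sigma^2))]; the condition on [t]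
    makes this smaller than any fixed power of [eps eta / Delta] when [K] is large. *)

Require Import Defs.
From HB Require Import structures.
From mathcomp Require Import all_boot all_order all_algebra.
From mathcomp Require Import spectral complex.
From mathcomp Require Import all_classical all_reals all_analysis.
From mathcomp Require Import measurable_realfun simple_functions measurable_fun_approximation.
From mathcomp Require Import ring lra.
Set Implicit Arguments.
Unset Strict Implicit.
Unset Printing Implicit Defensive.
Import Order.TTheory GRing.Theory Num.Theory.
Import numFieldNormedType.Exports.
Local Open Scope classical_set_scope.
Local Open Scope ring_scope.

(** * Expectations of products of independent variables *)

(** The guess is within [Delta / 3] of [phi0] and the window has half-width [Delta / 2], so [phi0]
    keeps a margin [Delta / 6] inside the window; by the gap, the other eigenphases stay at least
    [Delta / 6] away from it. The tail is thus the kernel at [Delta / 6], whence the 72. The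
    asymptotic variance is a limit of [M] times the variance, so exceptional events must contribute
    [o(1 / M)]. Second moments would only give [O(1 / M)]; this is why fourth moments of sample
    means appear. On these events the only fact used about the estimate is that it lies in [[0, 2
    pi[]. The inverse of [mu] has no closed form. A lower bound [1 / 48] on its slope within
    [Delta / 12] of [phi0] replaces it; the bound comes from a lower bound on the variance of the
    truncated Gaussian, and the factor 48 reappears in the bias and, squared, in the variance. The
    factor [eta^-1] in [M'] comes from the retained fraction alone, which is at least [eta / 3]
    whatever the width of the kernel. Independence is assumed for events, so it is carried over to
    products of functions before any moment is computed. *)

Section ge0_integral_weighted.
Local Open Scope ereal_scope.
Context d1 d2 (T : measurableType d1) (U : measurableType d2) (R : realType).
Context (mu : {measure set T -> \bar R}) (nu : {measure set U -> \bar R}).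
Context (X : T -> U) (w : T -> R).
Hypotheses (mX : measurable_fun setT X) (mw : measurable_fun setT w).
Hypothesis w_ge0 : forall x, (0 <= w x)%R.
Hypothesis nuE : forall A, measurable A ->
  nu A = \int[mu]_(x in X @^-1` A) (w x)%:E.

Import HBNNSimple.

(** [nu] is the image under [X] of the measure with density [w], known on sets only. Two instances
    matter: [w] a product of the other independent factors, and [X] the identity with [w] a
    probability density. *)
Lemma ge0_integral_weighted (f : U -> \bar R) :
  measurable_fun setT f -> (forall y, 0 <= f y) ->
  \int[nu]_y f y = \int[mu]_x (f (X x) * (w x)%:E).
Proof.
move=> mf f0; pose h := nnsfun_approx measurableT mf.
have mXpre A : measurable A -> measurable (X @^-1` A).
  by move=> mA; rewrite -[_ @^-1` _]setTI; apply: mX.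
have mwE : measurable_fun setT (EFin \o w) by exact/measurable_EFinP.
have -> : \int[nu]_y f y = limn (fun n => \int[nu]_y (h n y)%:E).
  rewrite -monotone_convergence//.
  - apply: eq_integral => y _; apply/esym/cvg_lim => //.
    by apply: cvg_nnsfun_approx => // *; exact: f0.
  - by move=> n; exact/measurable_EFinP/measurable_funP.
  - by move=> n y _; rewrite lee_fin.
  - by move=> y _ m n mn; rewrite lee_fin; exact/lefP/nd_nnsfun_approx.
have mhX n : measurable_fun setT (fun x => (h n (X x))%:E).
  by apply/measurable_EFinP; exact: measurableT_comp.
have -> : \int[mu]_x (f (X x) * (w x)%:E) =
    limn (fun n => \int[mu]_x ((h n (X x))%:E * (w x)%:E)).
  rewrite -monotone_convergence//.
  - apply: eq_integral => x _; apply/esym/cvg_lim => //.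
    apply: cvgeZr => //; apply: cvg_nnsfun_approx => // *; exact: f0.
  - by move=> n; exact: emeasurable_funM.
  - by move=> n x _; rewrite mule_ge0// lee_fin.
  - move=> x _ m n mn; rewrite lee_wpmul2r ?lee_fin//.
    exact/lefP/nd_nnsfun_approx.
congr (limn _); apply/funext => n.
under eq_integral do rewrite fimfunE -fsumEFin//.
rewrite ge0_integral_fsum//; last 2 first.
- by move=> y; exact/measurable_EFinP/measurable_funM.
- by move=> y x _; rewrite nnfun_muleindic_ge0.
transitivity (\int[mu]_x (\sum_(y \in range (h n))
    (y * \1_(h n @^-1` [set y]) (X x))%:E * (w x)%:E)); last first.
  apply: eq_integral => x _.
  rewrite -ge0_mule_fsuml => [|y]; last exact: nnfun_muleindic_ge0.
  by rewrite fsumEFin// -fimfunE.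
rewrite ge0_integral_fsum//; last 2 first.
- move=> y; apply: emeasurable_funM => //; apply/measurable_EFinP.
  apply: measurable_funM => //; apply: (measurableT_comp _ mX) => //.
- move=> y x _; apply: mule_ge0; last by rewrite lee_fin.
  exact: nnfun_muleindic_ge0.
apply: eq_fsbigr => r rhn.
have r0 : (0 <= r)%R by move: rhn; rewrite inE => -[t _ <-].
rewrite integralZl_indic_nnsfun// integral_indic// setIT nuE//.
under [RHS]eq_integral do rewrite EFinM -muleA.
rewrite ge0_integralZl//; last 2 first.
- apply: emeasurable_funM => //; apply/measurable_EFinP.
  exact: (measurableT_comp _ mX).
- by move=> x _; rewrite mule_ge0 ?lee_fin.
congr (_ * _); rewrite integral_mkcond; apply: eq_integral => x _.
rewrite patchE/=; case: ifPn => [|/negP].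
  by rewrite !inE => hx; rewrite indicE mem_set// mul1e.
by rewrite !inE => hx; rewrite indicE memNset// mul0e.
Qed.

End ge0_integral_weighted.

(** Estimates lie in [[0, 2 pi[] and samples will be clipped to the window, so all random quantities
    fall in this class; its closure properties replace separate integrability arguments. *)
Definition bounded_measurable d (T : measurableType d) (R : realType)
    (f : T -> R) : Prop :=
  measurable_fun setT f /\ exists B : R, forall x, `|f x| <= B.

Section bounded_measurable_theory.
Context d (T : measurableType d) (R : realType).
Implicit Types f g : T -> R.

Lemma bounded_measurable_cst (c : R) : bounded_measurable (fun _ : T => c).
Proof. by split; [exact: measurable_cst|exists `|c|]. Qed.

Lemma bounded_measurableD f g : bounded_measurable f -> bounded_measurable g ->
  bounded_measurable (fun x => f x + g x).
Proof.
move=> [mf [B fB]] [mg [C gC]]; split; first exact: measurable_funD.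
by exists (B + C) => x; rewrite (le_trans (ler_normD _ _))// lerD.
Qed.

Lemma bounded_measurableM f g : bounded_measurable f -> bounded_measurable g ->
  bounded_measurable (fun x => f x * g x).
Proof.
move=> [mf [B fB]] [mg [C gC]]; split; first exact: measurable_funM.
by exists (B * C) => x; rewrite normrM ler_pM.
Qed.

Lemma bounded_measurableN f : bounded_measurable f ->
  bounded_measurable (fun x => - f x).
Proof.
move=> [mf [B fB]]; split; first exact: measurableT_comp.
by exists B => x; rewrite normrN.
Qed.

Lemma bounded_measurable_norm f : bounded_measurable f ->
  bounded_measurable (fun x => `|f x|).
Proof.
move=> [mf [B fB]]; split; first exact: measurableT_comp.
by exists B => x; rewrite normr_id.
Qed.

Lemma bounded_measurableX f n : bounded_measurable f ->
  bounded_measurable (fun x => f x ^+ n).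
Proof.
move=> mf; elim: n => [|n IH]; first exact: bounded_measurable_cst.
under eq_fun do rewrite exprS.
exact: bounded_measurableM.
Qed.

Lemma bounded_measurable_sum I (s : seq I) (h : I -> T -> R) :
  (forall i, bounded_measurable (h i)) ->
  bounded_measurable (fun x => \sum_(i <- s) h i x).
Proof.
move=> mh; elim: s => [|i s IH].
  by under eq_fun do rewrite big_nil; exact: bounded_measurable_cst.
by under eq_fun do rewrite big_cons; exact: bounded_measurableD.
Qed.

Lemma bounded_measurable_prod I (s : seq I) (h : I -> T -> R) :
  (forall i, bounded_measurable (h i)) ->
  bounded_measurable (fun x => \prod_(i <- s) h i x).
Proof.
move=> mh; elim: s => [|i s IH].
  by under eq_fun do rewrite big_nil; exact: bounded_measurable_cst.
by under eq_fun do rewrite big_cons; exact: bounded_measurableM.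
Qed.

Lemma bounded_measurable_indic (A : set T) : measurable A ->
  bounded_measurable (\1_A : T -> R).
Proof.
move=> mA; split; first exact: measurable_indic.
by exists 1 => x; rewrite indicE ger0_norm// lern1 leq_b1.
Qed.

Lemma bounded_measurable_comp d' (U : measurableType d') (Y : U -> T) f :
  measurable_fun setT Y -> bounded_measurable f ->
  bounded_measurable (fun x => f (Y x)).
Proof.
move=> mY [mf [B fB]]; split; first exact: (measurableT_comp mf mY).
by exists B.
Qed.

Lemma bounded_measurable_expR f : bounded_measurable f ->
  bounded_measurable (fun x => expR (f x)).
Proof.
move=> [mf [B fB]]; split; first exact: measurableT_comp.
exists (expR B) => x; rewrite ger0_norm ?expR_ge0// ler_expR.
exact: le_trans (ler_norm _) (fB x).
Qed.

Lemma bounded_measurable_integrable (mu : {measure set T -> \bar R}) A f :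
  measurable A -> (mu A < +oo)%E -> bounded_measurable f ->
  mu.-integrable A (EFin \o f).
Proof.
move=> mA finA [mf [B fB]]; apply: measurable_bounded_integrable => //.
  exact: measurable_funTS.
exists B; split; first exact: num_real.
by move=> M BM x _; exact: le_trans (fB x) (ltW BM).
Qed.

Variable Pr : probability T R.

Lemma bounded_measurable_expectation f : bounded_measurable f ->
  (\int[Pr]_x (f x)%:E)%E = (\int[Pr]_x f x)%:E.
Proof.
move=> mf; rewrite /Rintegral fineK//; apply: integrable_fin_num => //.
apply: bounded_measurable_integrable => //.
by rewrite (le_lt_trans (probability_le1 Pr measurableT))// ltry.
Qed.

Lemma bounded_measurable_Pintegrable f : bounded_measurable f ->
  Pr.-integrable setT (EFin \o f).
Proof.
apply: bounded_measurable_integrable => //.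
by rewrite (le_lt_trans (probability_le1 Pr measurableT))// ltry.
Qed.

Lemma Rexp_le f g : bounded_measurable f -> bounded_measurable g ->
  (forall x, f x <= g x) -> \int[Pr]_x f x <= \int[Pr]_x g x.
Proof.
move=> mf mg fg.
by apply: le_Rintegral => //; exact: bounded_measurable_Pintegrable.
Qed.

Lemma Rexp_cst (c : R) : \int[Pr]_(_ in setT) c = c.
Proof. by rewrite Rintegral_cst//= probability_setT mulr1. Qed.

Lemma RexpD f g : bounded_measurable f -> bounded_measurable g ->
  \int[Pr]_x (f x + g x) = \int[Pr]_x f x + \int[Pr]_x g x.
Proof.
by move=> mf mg; apply: RintegralD => //; exact: bounded_measurable_Pintegrable.
Qed.

Lemma RexpB f g : bounded_measurable f -> bounded_measurable g ->
  \int[Pr]_x (f x - g x) = \int[Pr]_x f x - \int[Pr]_x g x.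
Proof.
by move=> mf mg; apply: RintegralB => //; exact: bounded_measurable_Pintegrable.
Qed.

Lemma RexpZ (c : R) f : bounded_measurable f ->
  \int[Pr]_x (c * f x) = c * \int[Pr]_x f x.
Proof.
by move=> mf; apply: RintegralZl => //; exact: bounded_measurable_Pintegrable.
Qed.

Lemma Rexp_sum I (s : seq I) (h : I -> T -> R) :
  (forall i, bounded_measurable (h i)) ->
  \int[Pr]_x (\sum_(i <- s) h i x) = \sum_(i <- s) \int[Pr]_x h i x.
Proof.
move=> mh; elim: s => [|i s IH].
  by under eq_Rintegral do rewrite big_nil; rewrite Rexp_cst big_nil.
under eq_Rintegral do rewrite big_cons.
by rewrite RexpD ?IH ?big_cons//; exact: bounded_measurable_sum.
Qed.

Lemma Rexp_sqr_ge f : bounded_measurable f ->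
  (\int[Pr]_x f x) ^+ 2 <= \int[Pr]_x (f x ^+ 2).
Proof.
move=> mf; set m := \int[Pr]_x f x.
have mC c := @bounded_measurable_cst c.
have : 0 <= \int[Pr]_x (f x - m) ^+ 2 by apply: Rintegral_ge0 => x _; exact: sqr_ge0.
under eq_Rintegral => x _.
  rewrite (_ : _ ^+ 2 = f x ^+ 2 - (2 * m * f x - m ^+ 2)); last by ring.
  over.
rewrite RexpB; last 2 first.
- exact: bounded_measurableX.
- apply: bounded_measurableD; first exact: bounded_measurableM.
  exact: mC.
rewrite RexpB; last 2 first.
- exact: bounded_measurableM.
- exact: mC.
rewrite RexpZ// Rexp_cst -/m; nra.
Qed.

End bounded_measurable_theory.

(** * Product rule for independent samples *)

Section independence.
Context d (T : measurableType d) (R : realType) (Pr : probability T R).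

Lemma Rexp_indic (A : set T) : measurable A ->
  \int[Pr]_x (\1_A x : R) = fine (Pr A).
Proof. by move=> mA; rewrite /Rintegral integral_indic// setIT. Qed.

(** Both sides integrate [f] against a measure on the line. The hypothesis on indicators says that
    the law of [Y] weighted by [w] is the plain law scaled by the mean of [w]. *)
Lemma Rexp_weighted (Y : {RV Pr >-> R}) (w : T -> R) (f : R -> R) :
  bounded_measurable w -> (forall x, 0 <= w x) ->
  (forall A : set R, measurable A ->
    \int[Pr]_x (\1_A (Y x) * w x) = \int[Pr]_x (\1_A (Y x) : R) * \int[Pr]_x w x) ->
  bounded_measurable f -> (forall y, 0 <= f y) ->
  \int[Pr]_x (f (Y x) * w x) = \int[Pr]_x f (Y x) * \int[Pr]_x w x.
Proof.
move=> mw w0 wE mf f0.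
have mY : measurable_fun setT Y by [].
have Ew0 : 0 <= \int[Pr]_x w x by apply: Rintegral_ge0.
pose nu := mscale (NngNum Ew0) (distribution Pr Y).
have nuE A : measurable A -> nu A = (\int[Pr]_(x in Y @^-1` A) (w x)%:E)%E.
  move=> mA; have mYA : measurable (Y @^-1` A).
    by rewrite -[_ @^-1` _]setTI; apply: mY.
  rewrite /nu /mscale/= integral_mkcond.
  transitivity (\int[Pr]_x (\1_A (Y x) * w x)%:E)%E; last first.
    apply: eq_integral => x _; rewrite patchE/=; case: ifPn => [|/negP].
      by rewrite !inE => hx; rewrite indicE mem_set// mul1r.
    by rewrite !inE => hx; rewrite indicE memNset// mul0r.
  rewrite bounded_measurable_expectation; last first.
    apply: bounded_measurableM => //.
    by apply: bounded_measurable_comp => //; exact: bounded_measurable_indic.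
  rewrite wE// mulrC EFinM; congr (_ * _)%E.
  rewrite -[in RHS]/(\int[Pr]_x (\1_(Y @^-1` A) x)) Rexp_indic// fineK//.
  exact: fin_num_measure.
have mfE : measurable_fun setT (EFin \o f) by apply/measurable_EFinP; exact: mf.1.
have := ge0_integral_weighted mY mw.1 w0 nuE mfE.
move=> /(_ (fun y => f0 y))/=.
rewrite ge0_integral_mscale//; last by move=> y _; exact: f0.
rewrite ge0_integral_pushforward//=.
have mfY : bounded_measurable (fun x => f (Y x)).
  exact: bounded_measurable_comp.
under [X in _ = X -> _]eq_integral do rewrite -EFinM.
rewrite preimage_setT.
rewrite !bounded_measurable_expectation//; last exact: bounded_measurableM.
  by move=> [] <-; rewrite mulrC.
by move=> y _; rewrite lee_fin.
Qed.

Variable X : nat -> {RV Pr >-> R}.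
Hypothesis indX : mutually_independent X.

Lemma Rexp_prod_indic (s : seq nat) (A : nat -> set R) : uniq s ->
  (forall k, measurable (A k)) ->
  \int[Pr]_x (\prod_(k <- s) \1_(A k) (X k x) : R) =
  \prod_(k <- s) \int[Pr]_x (\1_(A k) (X k x) : R).
Proof.
move=> us mA.
have mXA k : measurable (X k @^-1` A k).
  by rewrite -[_ @^-1` _]setTI; apply: (measurable_funP (X k)).
have mbig s' : measurable (\big[setI/setT]_(k <- s') (X k @^-1` A k)).
  by elim/big_ind: _ => //; exact: measurableI.
have indE x s' : \prod_(k <- s') \1_(A k) (X k x) =
    \1_(\big[setI/setT]_(k <- s') (X k @^-1` A k)) x :> R.
  elim: s' => [|k s' IH]; first by rewrite !big_nil indicT.
  by rewrite !big_cons IH indicI.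
under eq_Rintegral do rewrite indE.
rewrite Rexp_indic// indX//.
have -> : (\prod_(k <- s) Pr (X k @^-1` A k) =
    \prod_(k <- s) (fine (Pr (X k @^-1` A k)))%:E)%E.
  by apply: eq_bigr => k _; rewrite fineK// fin_num_measure.
rewrite prodEFin/=; apply: eq_bigr => k _.
by rewrite -Rexp_indic.
Qed.

(* Indicators are replaced by functions one factor at a time, each step being
   [Rexp_weighted] with the product of the other factors as weight. *)
Lemma Rexp_prod_aux (f : nat -> R -> R) :
  (forall k, bounded_measurable (f k)) -> (forall k y, 0 <= f k y) ->
  forall (s1 s2 : seq nat) (A : nat -> set R), uniq (s1 ++ s2) ->
  (forall k, measurable (A k)) ->
  \int[Pr]_x (\prod_(k <- s1) f k (X k x) * \prod_(k <- s2) \1_(A k) (X k x)) =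
  \prod_(k <- s1) \int[Pr]_x f k (X k x) *
  \prod_(k <- s2) \int[Pr]_x (\1_(A k) (X k x) : R).
Proof.
move=> mf f0; elim=> [|k s1 IH] s2 A us mA.
  under eq_Rintegral do rewrite big_nil mul1r.
  by rewrite big_nil mul1r Rexp_prod_indic.
have mfX i : bounded_measurable (fun x => f i (X i x)).
  by apply: bounded_measurable_comp.
have mAX i : bounded_measurable (fun x => \1_(A i) (X i x) : R).
  by apply: bounded_measurable_comp => //; exact: bounded_measurable_indic.
have us' : uniq (s1 ++ k :: s2).
  by rewrite (perm_uniq (permEl (perm_catC s1 (k :: s2))))/= mem_cat orbC
    -mem_cat -(perm_uniq (permEl (perm_catC s1 s2))) in us *.
have us2 : uniq (s1 ++ s2) by move: us => /= /andP[].
under eq_Rintegral do rewrite big_cons -mulrA.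
rewrite (@Rexp_weighted _ (fun x => \prod_(k <- s1) f k (X k x) *
    \prod_(k <- s2) \1_(A k) (X k x))).
- by rewrite IH// big_cons mulrA.
- by apply: bounded_measurableM; exact: bounded_measurable_prod.
- by move=> x; rewrite mulr_ge0// prodr_ge0.
- move=> B mB; rewrite IH//.
  (* [k] moves from the functions to the indicators, with the set [B]. By uniqueness it does not
     occur in [s2], so the other sets are unchanged. *)
  pose A' i := if i == k then B else A i.
  have mA' i : measurable (A' i) by rewrite /A'; case: ifP.
  have A's2 i : i \in s2 -> A' i = A i.
    move=> is2; rewrite /A'; case: eqP => // ik.
    by move: us => /= /andP[]; rewrite mem_cat -ik is2 orbT.
  have A'k : A' k = B by rewrite /A' eqxx.
  have := IH (k :: s2) A' us' mA'.
  have A'E x : \prod_(i <- k :: s2) \1_(A' i) (X i x) =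
      \1_B (X k x) * \prod_(i <- s2) \1_(A i) (X i x) :> R.
    rewrite big_cons A'k; congr (_ * _).
    by apply: eq_big_seq => i is2; rewrite A's2.
  under eq_Rintegral do rewrite A'E mulrCA.
  move=> ->; rewrite big_cons A'k mulrCA; congr (_ * (_ * _)).
  by apply: eq_big_seq => i is2; rewrite A's2.
- exact: mf.
- exact: f0.
Qed.

Lemma Rexp_prod (f : nat -> R -> R) (s : seq nat) : uniq s ->
  (forall k, bounded_measurable (f k)) -> (forall k y, 0 <= f k y) ->
  \int[Pr]_x (\prod_(k <- s) f k (X k x)) = \prod_(k <- s) \int[Pr]_x f k (X k x).
Proof.
move=> us mf f0.
have := @Rexp_prod_aux f mf f0 s [::] (fun=> setT); rewrite cats0.
move=> /(_ us (fun=> measurableT)).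
under eq_Rintegral do rewrite big_nil mulr1.
by rewrite big_nil mulr1.
Qed.

End independence.

(** * Moments of sample means and the delta method *)

(** [1 - u <= expR (- u)] gives [(1 - u) * expR u <= 1], while [(1 - u) * (1 + u + 2 * u ^+ 2) = 1 +
    u ^+ 2 * (1 - 2 * u)] is at least 1 on this range. *)
Lemma expR_le_quadratic (R : realType) (u : R) : `|u| <= 2^-1 ->
  expR u <= 1 + u + 2 * u ^+ 2.
Proof.
rewrite ler_norml => /andP[u1 u2].
have h := expR_ge1Dx (- u).
have e := expRxMexpNx_1 u; have p := expR_gt0 u.
have : (1 - u) * (1 + u + 2 * u ^+ 2) >= 1 by nra.
move=> h2; have : (1 - u) * expR u <= 1 by nra.
nra.
Qed.

(** Bounds a fourth moment by two moment generating functions, which factor over independent terms,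
    so the fourth power of a sum is never expanded. The 24 is [4!], from the exponential series. *)
Lemma expR_ge_pow4 (R : realType) (u : R) :
  u ^+ 4 <= 24 * (expR u + expR (- u)).
Proof.
wlog u0 : u / 0 <= u => [h|].
  have [/h//|u0] := leP 0 u.
  have := h (- u); rewrite opprK addrC oppr_ge0 => /(_ (ltW u0)).
  by rewrite exprNn/= (_ : (-1) ^+ 4 = 1) ?mul1r//; ring.
have := @expR_ge1Dxn _ u 3 u0; have := expR_gt0 (- u).
rewrite (_ : 4`!%:R = 24 :> R)//; nra.
Qed.

Section moments.
Context d (T : measurableType d) (R : realType) (Pr : probability T R).
Variable X : nat -> {RV Pr >-> R}.
Hypothesis indX : mutually_independent X.
Variables (h : R -> R) (v : R).
Hypothesis mh : bounded_measurable h.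
Hypothesis h1 : forall k, \int[Pr]_x h (X k x) = 0.
Hypothesis h2 : forall k, \int[Pr]_x (h (X k x)) ^+ 2 = v.

Let mhX k : bounded_measurable (fun x => h (X k x)).
Proof. exact: bounded_measurable_comp. Qed.

Let mhN k : bounded_measurable (fun x => \sum_(i < k) h (X i x)).
Proof. exact: bounded_measurable_sum. Qed.

Lemma Rexp_centered_sum n : \int[Pr]_x (\sum_(k < n) h (X k x)) = 0.
Proof. by rewrite Rexp_sum// big1. Qed.

(** The product rule is available for nonnegative functions; [h] is shifted by its bound [B], and
    the terms in [B] cancel after expansion. *)
Lemma Rexp_centered_pair i j : i != j -> \int[Pr]_x (h (X i x) * h (X j x)) = 0.
Proof.
move=> ij; have [_ [B hB]] := mh.
have mhB : bounded_measurable (fun y => h y + B).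
  by apply: bounded_measurableD => //; exact: bounded_measurable_cst.
have hB0 (k : nat) y : 0 <= h y + B.
  by have := hB y; rewrite ler_norml => /andP[? _]; rewrite -lerBlDr sub0r.
have us : uniq [:: i; j] by rewrite /= inE ij.
have := Rexp_prod indX us (fun=> mhB) hB0.
rewrite big_cons big_seq1.
have mC := bounded_measurable_cst T B.
rewrite !RexpD// !h1 Rexp_cst.
under eq_Rintegral => x _.
  rewrite big_cons big_seq1.
  rewrite (_ : _ * _ = h (X i x) * h (X j x) + (B * h (X i x) +
    (B * h (X j x) + B * B))); last by ring.
  over.
have mB k : bounded_measurable (fun x => B * h (X k x)).
  exact: bounded_measurableM.
rewrite RexpD; last 2 first.
- exact: bounded_measurableM.
- apply: bounded_measurableD => //; apply: bounded_measurableD => //.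
  exact: bounded_measurable_cst.
rewrite RexpD//; last first.
  by apply: bounded_measurableD => //; exact: bounded_measurable_cst.
rewrite RexpD//; last exact: bounded_measurable_cst.
by rewrite !RexpZ// !h1 Rexp_cst; lra.
Qed.

Lemma Rexp_centered_sum_sqr n :
  \int[Pr]_x (\sum_(k < n) h (X k x)) ^+ 2 = v *+ n.
Proof.
under eq_Rintegral => x _.
  rewrite expr2 mulr_suml; under eq_bigr do rewrite mulr_sumr.
  over.
have mhh i j : bounded_measurable (fun x => h (X i x) * h (X j x)).
  exact: bounded_measurableM.
rewrite Rexp_sum; last by move=> i; exact: bounded_measurable_sum.
under eq_bigr => i _.
  rewrite Rexp_sum// (bigD1 i)//= big1 ?addr0; last first.
    by move=> j ji; rewrite Rexp_centered_pair// eq_sym.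
  under eq_Rintegral do rewrite -expr2.
  rewrite h2; over.
by rewrite sumr_const card_ord.
Qed.

(** The linear term of each factor has mean zero, which leaves at most [1 + 2 * (lam * B) ^+ 2],
    itself below an exponential. *)
Lemma Rexp_expR_centered_sum n (B lam : R) : (forall y, `|h y| <= B) ->
  `|lam| * B <= 2^-1 ->
  \int[Pr]_x expR (lam * \sum_(k < n) h (X k x)) <=
  expR (2 * (lam * B) ^+ 2 *+ n).
Proof.
move=> hB lB.
have lh y : `|lam * h y| <= 2^-1 by rewrite normrM (le_trans _ lB)// ler_wpM2l.
have mlh : bounded_measurable (fun y => lam * h y).
  by apply: bounded_measurableM => //; exact: bounded_measurable_cst.
have mE : bounded_measurable (fun y => expR (lam * h y)).
  exact: bounded_measurable_expR.
rewrite -mulr_natl mulrC expRM_natr.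
under eq_Rintegral do rewrite mulr_sumr expR_sum.
have -> : \int[Pr]_x (\prod_(k < n) expR (lam * h (X k x))) =
    \prod_(k < n) \int[Pr]_x expR (lam * h (X k x)).
  have us : uniq (index_iota 0 n) by exact: iota_uniq.
  have := Rexp_prod indX us (fun=> mE) (fun _ _ => expR_ge0 _).
  by under eq_Rintegral do rewrite big_mkord; rewrite big_mkord.
rewrite -[n in leRHS]card_ord -prodr_const; apply: ler_prod => k _.
apply/andP; split; first by apply: Rintegral_ge0 => x _; exact: expR_ge0.
apply: (@le_trans _ _ (1 + 2 * (lam * B) ^+ 2)); last exact: expR_ge1Dx.
apply: (@le_trans _ _ (\int[Pr]_x (1 + 2 * (lam * B) ^+ 2 + lam * h (X k x)))).
  have mlhX := bounded_measurable_comp (f := fun y => lam * h y) (Y := X k).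
  apply: Rexp_le.
  - exact: (bounded_measurable_comp (f := fun y => expR (lam * h y))).
  - apply: bounded_measurableD; first exact: bounded_measurable_cst.
    exact: mlhX.
  - move=> x; apply: le_trans (expR_le_quadratic (lh _)) _.
    have : (lam * h (X k x)) ^+ 2 <= (lam * B) ^+ 2.
      rewrite -[leLHS]real_normK ?num_real//.
      rewrite -[leRHS]real_normK ?num_real// lerXn2r ?nnegrE// !normrM.
      by rewrite ler_wpM2l// (le_trans (hB _))// ler_norm.
    lra.
rewrite RexpD; last 2 first.
- exact: bounded_measurable_cst.
- exact: (bounded_measurable_comp (f := fun y => lam * h y)).
by rewrite Rexp_cst RexpZ// h1 mulr0 addr0.
Qed.

(* [expR_ge_pow4] at [u = lam * S], where [lam = (2 * B * sqrt n)^-1] keeps the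
   moment generating function of the sum [S] bounded. *)
Lemma Rexp_centered_sum_pow4 :
  exists2 C : R, 0 <= C & forall n, (0 < n)%N ->
    \int[Pr]_x (\sum_(k < n) h (X k x)) ^+ 4 <= C * n%:R ^+ 2.
Proof.
have [_ [B0 hB0]] := mh.
pose B := `|B0| + 1; have B_gt0 : 0 < B by rewrite ltr_wpDl.
have hB y : `|h y| <= B.
  by rewrite (le_trans (hB0 y))// (le_trans (ler_norm _))// lerDl.
(* 96 is 24 times the bound [2 + 2] on the two generating functions, and [(2 * B) ^+ 4 * n%:R ^+ 2]
   is [lam ^- 4]. *)
exists (96 * (2 * B) ^+ 4) => [|n n0]; first by rewrite mulr_ge0// exprn_ge0// ltW// mulr_gt0.
pose s : R := Num.sqrt n%:R.
have s_gt0 : 0 < s by rewrite sqrtr_gt0 ltr0n.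
have s2 : s ^+ 2 = n%:R by rewrite sqr_sqrtr.
have s1 : 1 <= s.
  have : (1 : R) <= n%:R by rewrite ler1n.
  rewrite -s2; nra.
pose lam := (2 * B * s)^-1.
have l_gt0 : 0 < lam by rewrite invr_gt0 !mulr_gt0.
have lE : lam * (2 * B * s) = 1 by rewrite /lam mulVf// gt_eqF// !mulr_gt0.
have lB : lam * B <= 2^-1.
  have : lam * B * 2 * s = 1 by rewrite -[RHS]lE; ring.
  have : 0 < lam * B by rewrite mulr_gt0.
  nra.
set S := fun x => \sum_(k < n) h (X k x).
have mS : bounded_measurable S by exact: mhN.
have expS (e : R) : e ^+ 2 = 1 -> \int[Pr]_x expR (e * lam * S x) <= 2.
  move=> e1; have ne : `|e| = 1.
    have : `|e| ^+ 2 = 1 by rewrite real_normK ?num_real.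
    have := normr_ge0 e; nra.
  apply: (le_trans (@Rexp_expR_centered_sum n B (e * lam) hB _)).
    by rewrite normrM ne mul1r gtr0_norm.
  have -> : 2 * (e * lam * B) ^+ 2 *+ n = 2^-1.
    rewrite -mulr_natr -s2.
    have gen (a b c f : R) : 2 * (a * b * c) ^+ 2 * f ^+ 2 =
      a ^+ 2 * (b * (2 * c * f)) ^+ 2 / 2 by field.
    by rewrite gen e1 lE expr1n !mul1r.
  have := expR_ge1Dx (- 2^-1 : R); have := expRxMexpNx_1 (2^-1 : R).
  have := expR_gt0 (2^-1 : R); nra.
have E1 := expS 1 (expr1n _ _).
have E2 : \int[Pr]_x expR (-1 * lam * S x) <= 2 by apply: expS; rewrite sqrrN expr1n.
have mlS (e : R) : bounded_measurable (fun x => expR (e * lam * S x)).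
  apply: bounded_measurable_expR; apply: bounded_measurableM => //.
  exact: bounded_measurable_cst.
have bnd : \int[Pr]_x S x ^+ 4 <=
    \int[Pr]_x (24 * lam ^- 4 * (expR (1 * lam * S x) + expR (-1 * lam * S x))).
  apply: Rexp_le.
  - exact: bounded_measurableX.
  - apply: bounded_measurableM; first exact: bounded_measurable_cst.
    exact: bounded_measurableD.
  - move=> x; have := expR_ge_pow4 (lam * S x).
    rewrite !mul1r !mulN1r mulNr exprMn mulrC -ler_pdivlMr ?exprn_gt0//.
    by rewrite mulrAC.
apply: (le_trans bnd); rewrite RexpZ//; last exact: bounded_measurableD.
rewrite RexpD//.
have -> : lam ^- 4 = (2 * B) ^+ 4 * n%:R ^+ 2.
  by rewrite /lam exprVn invrK -s2; ring.
have : 0 <= (2 * B) ^+ 4 * n%:R ^+ 2.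
  by rewrite mulr_ge0// exprn_ge0// mulr_ge0// ltW.
set A := _ * n%:R ^+ 2 => A0; rewrite -[leRHS]mulrA -/A.
rewrite (_ : 96 * A = 24 * A * (2 + 2)); last by ring.
by apply: ler_wpM2l (lerD E1 E2); rewrite mulr_ge0.
Qed.

End moments.

(** * Delta method *)

Section delta_method.
Context d (T : measurableType d) (R : realType) (Pr : probability T R).

(** The centre [c] is free so that the variance of the estimates can be expanded around their limit
    [p], and that of a sample around two centres in turn. *)
Lemma variance_bounded_measurable (f : T -> R) (c : R) : bounded_measurable f ->
  'V_Pr[f]%E = (\int[Pr]_x (f x - c) ^+ 2 - (\int[Pr]_x (f x - c)) ^+ 2)%:E.
Proof.
move=> mf.
have Ef : 'E_Pr[f]%E = (\int[Pr]_x f x)%:E.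
  by rewrite unlock bounded_measurable_expectation.
rewrite /variance covariance.unlock Ef/=.
have mC (b : R) := @bounded_measurable_cst _ T R b.
have mfB b : bounded_measurable (fun x => f x - b).
  by apply: bounded_measurableD.
rewrite unlock.
under eq_integral do rewrite !fctE -expr2.
rewrite bounded_measurable_expectation; last exact: (bounded_measurableX 2 (mfB _)).
set m := \int[Pr]_x f x; congr EFin.
have -> : \int[Pr]_x (f x - c) = m - c by rewrite RexpB// Rexp_cst.
have E b : \int[Pr]_x (f x - b) ^+ 2 = \int[Pr]_x (f x ^+ 2) - 2 * b * m + b ^+ 2.
  under eq_Rintegral => x _.
    rewrite (_ : _ ^+ 2 = f x ^+ 2 + (- (2 * b) * f x + b ^+ 2)); last by ring.
    over.
  have m1 : bounded_measurable (fun x => - (2 * b) * f x) by exact: bounded_measurableM.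
  have m2 := bounded_measurableD m1 (mC (b ^+ 2)).
  have m3 := bounded_measurableX 2 mf.
  by rewrite RexpD// RexpD// RexpZ// Rexp_cst -/m; ring.
by rewrite !E; ring.
Qed.

(* [S] is the centred sample mean and [c] the derivative of the estimate with
   respect to it; [W], of order [1 / M ^+ 2] in mean, dominates the error on the
   event where the linearization is not available. *)
Variables (est : nat -> {RV Pr >-> R}) (S W : nat -> T -> R) (p c v B C : R).
Hypothesis est_bound : forall M x, `|est M x| <= B.
Hypothesis S_bm : forall M, bounded_measurable (S M).
Hypothesis S_bound : forall M x, `|S M x| <= B.
Hypothesis W_bm : forall M, bounded_measurable (W M).
Hypothesis W_ge0 : forall M x, 0 <= W M x.
Hypothesis S_mean : forall M, (0 < M)%N -> \int[Pr]_x S M x = 0.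
Hypothesis S_sqr : forall M, (0 < M)%N -> \int[Pr]_x (S M x) ^+ 2 = v / M%:R.
Hypothesis W_mean : forall M, (0 < M)%N -> \int[Pr]_x W M x <= C / M%:R ^+ 2.
Hypothesis linearized : forall e, 0 < e -> exists2 L, 0 <= L &
  forall M x, (0 < M)%N -> `|est M x - p - c * S M x| <= e * `|S M x| + L * W M x.

Let Y M x := est M x - p.
Let r M x := Y M x - c * S M x.

Let est_bm M : bounded_measurable (est M).
Proof. by split=> //; exists B. Qed.

Let Y_bm M : bounded_measurable (Y M).
Proof. by apply: bounded_measurableD => //; exact: bounded_measurable_cst. Qed.

Let cS_bm M a : bounded_measurable (fun x => a * S M x).
Proof. by apply: bounded_measurableM => //; exact: bounded_measurable_cst. Qed.

Let r_bm M : bounded_measurable (r M).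
Proof. by apply: bounded_measurableD => //; apply: bounded_measurableN. Qed.

Let B2 := B + `|p| + `|c| * B.

Let r_bound M x : `|r M x| <= B2.
Proof.
rewrite /r /Y (le_trans (ler_normB _ _))// lerD//.
  by rewrite (le_trans (ler_normB _ _))// lerD.
by rewrite normrM ler_wpM2l.
Qed.

Let B_ge0 : 0 <= B.
Proof. by rewrite (le_trans (normr_ge0 _) (est_bound 0 point)). Qed.

Let B2_ge0 : 0 <= B2.
Proof. by rewrite !addr_ge0// mulr_ge0. Qed.

Let v_ge0 : 0 <= v.
Proof.
have := S_sqr (ltn0Sn 0); rewrite divr1 => <-.
by apply: Rintegral_ge0 => x _; exact: sqr_ge0.
Qed.

Let C_ge0 : 0 <= C.
Proof.
have := W_mean (ltn0Sn 0); rewrite expr1n divr1; apply: le_trans.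
by apply: Rintegral_ge0.
Qed.

(** Only the first power of [W] has a known mean. In every product that involves [W], the other
    factor [r] or [S] is replaced by its constant bound, so no square of [W] arises. *)
Let quadratic_comparison e : 0 < e -> exists2 K, 0 <= K & forall M, (0 < M)%N ->
  (\int[Pr]_x (r M x) ^+ 2 <= e ^+ 2 * (v / M%:R) + K / M%:R ^+ 2) /\
  `|\int[Pr]_x (Y M x) ^+ 2 - c ^+ 2 * (v / M%:R)| <=
  (e ^+ 2 + 2 * `|c| * e) * (v / M%:R) + K / M%:R ^+ 2.
Proof.
move=> e0; have [L L0 hL] := linearized e0.
(* The summands are the coefficients of [W] in the bounds on [r ^+ 2] and on the cross term
   [2 * c * S * r]. *)
pose K0 := (B2 + e * B) * L + 2 * `|c| * B * L.
have K0_ge0 : 0 <= K0.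
  by rewrite addr_ge0 ?mulr_ge0// addr_ge0// mulr_ge0// ltW.
exists (K0 * C) => [|M M0]; first exact: mulr_ge0.
have rr x : `|r M x| ^+ 2 <= e ^+ 2 * S M x ^+ 2 + (B2 + e * B) * L * W M x.
  have := hL M x M0; rewrite -/(Y M x) -/(r M x).
  have := r_bound M x; have := S_bound M x; have := W_ge0 M x.
  rewrite -[S M x ^+ 2]real_normK ?num_real//.
  have := normr_ge0 (S M x); have := normr_ge0 (r M x).
  move: (`|r M x|) (`|S M x|) (W M x) => a s w a0 s0 w0 sB aB ha.
  have Lw0 : 0 <= L * w by exact: mulr_ge0.
  have es0 : 0 <= e * s by rewrite mulr_ge0// ltW.
  have h1 : a * a <= a * (e * s + L * w) by exact: ler_wpM2l.
  have h2 : a * (L * w) <= B2 * (L * w) by exact: ler_wpM2r.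
  have h3 : (e * s) * a <= (e * s) * (e * s + L * w) by exact: ler_wpM2l.
  have h4 : (e * s) * (L * w) <= (e * B) * (L * w).
    by rewrite ler_wpM2r// ler_wpM2l// ltW.
  by rewrite !expr2; lra.
have yy x : `|Y M x ^+ 2 - c ^+ 2 * S M x ^+ 2| <=
    (e ^+ 2 + 2 * `|c| * e) * S M x ^+ 2 + K0 * W M x.
  have -> : Y M x ^+ 2 - c ^+ 2 * S M x ^+ 2 = r M x ^+ 2 + 2 * c * S M x * r M x.
    by rewrite /r; ring.
  apply: le_trans (ler_normD _ _) _; rewrite normrX !normrM (ger0_norm (ler0n _ 2)).
  have := rr x; have := hL M x M0; rewrite -/(Y M x) -/(r M x).
  have := S_bound M x; have := W_ge0 M x.
  rewrite -[S M x ^+ 2]real_normK ?num_real//.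
  have := normr_ge0 (S M x); have := normr_ge0 (r M x).
  move: (`|r M x|) (`|S M x|) (W M x) => a s w a0 s0 w0 sB ha haa.
  have c0 := normr_ge0 c.
  have Lw0 : 0 <= L * w by exact: mulr_ge0.
  have h1 : (2 * `|c| * s) * a <= (2 * `|c| * s) * (e * s + L * w).
    by apply: ler_wpM2l => //; rewrite !mulr_ge0.
  have h2 : (2 * `|c| * s) * (L * w) <= (2 * `|c| * B) * (L * w).
    by rewrite ler_wpM2r// ler_wpM2l// mulr_ge0.
  by rewrite /K0; lra.
have mC (b : R) := @bounded_measurable_cst _ T R b.
have SX := bounded_measurableX 2 (S_bm M).
have SXb b : bounded_measurable (fun x => b * S M x ^+ 2) by exact: bounded_measurableM.
have Wb b : bounded_measurable (fun x => b * W M x) by exact: bounded_measurableM.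
have KC : K0 * \int[Pr]_x W M x <= K0 * C / M%:R ^+ 2.
  by rewrite -mulrA ler_wpM2l// W_mean.
split.
  apply: (@le_trans _ _ (\int[Pr]_x (e ^+ 2 * S M x ^+ 2 + K0 * W M x))).
    apply: Rexp_le; [exact: bounded_measurableX|exact: bounded_measurableD|].
    move=> x; rewrite -[leLHS]real_normK ?num_real// (le_trans (rr x))//.
    rewrite lerD2l ler_wpM2r// /K0 lerDl !mulr_ge0//.
  by rewrite RexpD// !RexpZ// S_sqr// lerD2l.
rewrite -S_sqr// -RexpZ// -RexpB//; last exact: bounded_measurableX.
have mY2 := bounded_measurableX 2 (Y_bm M).
have mYS := bounded_measurableD mY2 (bounded_measurableN (SXb (c ^+ 2))).
apply: (le_trans (le_normr_Rintegral _ (bounded_measurable_Pintegrable Pr mYS))) => //.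
apply: (@le_trans _ _
  (\int[Pr]_x ((e ^+ 2 + 2 * `|c| * e) * S M x ^+ 2 + K0 * W M x))).
  apply: Rexp_le => //; first exact: bounded_measurable_norm.
  exact: bounded_measurableD.
by rewrite RexpD// !RexpZ// S_sqr// lerD2l.
Qed.

Let mean_Y_sqr M : (0 < M)%N ->
  (\int[Pr]_x Y M x) ^+ 2 <= \int[Pr]_x (r M x) ^+ 2.
Proof.
move=> M0; have -> : \int[Pr]_x Y M x = \int[Pr]_x r M x.
  by rewrite /r RexpB// RexpZ// S_mean// mulr0 subr0.
exact: Rexp_sqr_ge.
Qed.

Lemma delta_method_variance :
  (M%:R%:E * 'V_Pr[est M])%E @[M --> \oo] --> (c ^+ 2 * v)%:E.
Proof.
under eq_fun do rewrite (variance_bounded_measurable p)// -EFinM.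
apply: cvg_EFin; first exact: nearW.
apply/cvgrPdist_le => e e0.
(* [A] dominates [(2 + 2 * |c|) * v], the coefficient of [e'] in the total error once
   [e' ^+ 2 <= e']; the added ones keep it positive when [v = 0]. *)
pose A := (2 + 2 * `|c|) * (v + 1) + 1.
have A0 : 0 < A by rewrite addr_gt0// mulr_gt0// ltr_wpDl// mulr_ge0.
pose e' := Num.min 1 (e / (2 * A)).
have e'0 : 0 < e' by rewrite lt_min ltr01 divr_gt0// mulr_gt0.
have e'1 : e' <= 1 by rewrite ge_min lexx.
have e'A : e' * A <= e / 2.
  by rewrite -ler_pdivlMr// ge_min; apply/orP; right; rewrite invfM mulrA.
have [K K0 hK] := quadratic_comparison e'0.
near=> M.
have M0 : (0 < M)%N by near: M; exact: nbhs_infty_gt.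
have MR : (0 : R) < M%:R by rewrite ltr0n.
have [hr hY] := hK M M0; have hm := mean_Y_sqr M0.
have KM : 2 * K / M%:R <= e / 2.
  rewrite ler_pdivrMr// [leRHS]mulrC -ler_pdivrMr ?divr_gt0//.
  by near: M; exact: nbhs_infty_ger.
rewrite /= -/(Y M _).
change (`|c ^+ 2 * v - M%:R * (\int[Pr]_x (Y M x) ^+ 2 - (\int[Pr]_x Y M x) ^+ 2)| <= e).
set a := \int[Pr]_x (Y M x) ^+ 2 in hY *; set b := \int[Pr]_x Y M x in hm *.
set q := \int[Pr]_x (r M x) ^+ 2 in hr hm *.
have b2 : 0 <= b ^+ 2 by exact: sqr_ge0.
have -> : c ^+ 2 * v - M%:R * (a - b ^+ 2) =
    - M%:R * (a - c ^+ 2 * (v / M%:R)) + M%:R * b ^+ 2.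
  by field; rewrite gt_eqF.
apply: le_trans (ler_normD _ _) _.
rewrite 2!normrM normrN (gtr0_norm MR) (ger0_norm b2).
have h1 : M%:R * `|a - c ^+ 2 * (v / M%:R)| <=
    (e' ^+ 2 + 2 * `|c| * e') * v + K / M%:R.
  apply: le_trans (ler_wpM2l (ltW MR) hY) _.
  by rewrite le_eqVlt; apply/orP; left; apply/eqP; field; rewrite gt_eqF.
have h2 : M%:R * b ^+ 2 <= e' ^+ 2 * v + K / M%:R.
  apply: le_trans (ler_wpM2l (ltW MR) (le_trans hm hr)) _.
  by rewrite le_eqVlt; apply/orP; left; apply/eqP; field; rewrite gt_eqF.
have e'2 : e' ^+ 2 <= e' by rewrite expr2 ler_piMr// ltW.
have h3 : e' ^+ 2 * v <= e' * v by exact: ler_wpM2r.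
have h4 : (e' + 2 * `|c| * e') * v + e' * v <= e' * A.
  have c0 := normr_ge0 c.
  have : 0 <= e' * (2 + 2 * `|c| + 1) by rewrite mulr_ge0 ?ltW// !addr_ge0// mulr_ge0.
  by rewrite /A; nra.
apply: (le_trans (lerD h1 h2)).
have -> : (e' ^+ 2 + 2 * `|c| * e') * v + K / M%:R + (e' ^+ 2 * v + K / M%:R) =
  (e' ^+ 2 * v + 2 * `|c| * e' * v + e' ^+ 2 * v) + 2 * K / M%:R by ring.
by rewrite (splitr e) lerD//; nra.
Unshelve. all: end_near. Qed.

Lemma delta_method_mean (q : R) :
  ('E_Pr[est M] - q%:E)%E @[M --> \oo] --> (p - q)%:E.
Proof.
have E M : ('E_Pr[est M] - q%:E)%E = (\int[Pr]_x Y M x + (p - q))%:E.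
  rewrite unlock bounded_measurable_expectation// -EFinB; congr EFin.
  rewrite /Y RexpB//; last exact: bounded_measurable_cst.
  by rewrite Rexp_cst; ring.
under eq_fun do rewrite E.
apply: cvg_EFin; first exact: nearW.
(* Precision 1 is enough: [S] is centred, so [Y] has the mean of the remainder [r], whose square is
   at most [(v + K) / M]. *)
apply/cvgrPdist_le => e e0; have [K K0 hK] := quadratic_comparison ltr01.
near=> M.
have M0 : (0 < M)%N by near: M; exact: nbhs_infty_gt.
have MR : (1 : R) <= M%:R by rewrite ler1n.
have KM : (v + K) / M%:R <= e ^+ 2.
  rewrite ler_pdivrMr; last exact: lt_le_trans MR.
  rewrite [leRHS]mulrC -ler_pdivrMr ?exprn_gt0//.
  by near: M; exact: nbhs_infty_ger.
have [hr _] := hK M M0.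
have := le_trans (mean_Y_sqr M0) hr; rewrite expr1n mul1r => h.
change (`|p - q - (\int[Pr]_x Y M x + (p - q))| <= e).
rewrite (_ : _ - _ = - \int[Pr]_x Y M x); last by ring.
rewrite normrN.
rewrite -ler_sqr ?nnegrE ?(ltW e0)// real_normK ?num_real//.
apply: (le_trans h (le_trans _ KM)); rewrite mulrDl lerD2l.
rewrite ler_wpM2l// lef_pV2 ?posrE ?exprn_gt0// ?(lt_le_trans ltr01 MR)//.
by rewrite expr2 ler_pMr// (lt_le_trans ltr01 MR).
Unshelve. all: end_near. Qed.

End delta_method.

(** * The truncated Gaussian family *)

Section interval_integral.
Context (R : realType) (l r : R).
Implicit Types f g : R -> R.
Notation mu := (@lebesgue_measure R).

Lemma continuous_interval_integrable f : continuous f ->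
  mu.-integrable `[l, r] (EFin \o f).
Proof.
move=> cf; apply: continuous_compact_integrable; first exact: segment_compact.
exact: continuous_subspaceT.
Qed.

Lemma Rintegral_interval_le f g : continuous f -> continuous g ->
  (forall x, l <= x <= r -> f x <= g x) ->
  \int[mu]_(x in `[l, r]) f x <= \int[mu]_(x in `[l, r]) g x.
Proof.
by move=> cf cg fg; apply: le_Rintegral => //;
  exact: continuous_interval_integrable.
Qed.

Lemma Rintegral_interval_cst (a b c : R) : a <= b ->
  \int[mu]_(x in `[a, b]) c = c * (b - a).
Proof.
move=> ab; rewrite Rintegral_cst//= lebesgue_measure_itv/= lte_fin.
by move: ab; rewrite le_eqVlt => /predU1P[->|->]; rewrite ?ltxx ?subrr//=.
Qed.

Lemma Rintegral_interval_ub f (c : R) : l <= r -> continuous f ->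
  (forall x, l <= x <= r -> f x <= c) ->
  \int[mu]_(x in `[l, r]) f x <= c * (r - l).
Proof.
move=> lr cf fc; rewrite -Rintegral_interval_cst//.
by apply: Rintegral_interval_le => // x; exact: cvg_cst.
Qed.

Lemma Rintegral_interval_ge0 f : (forall x, l <= x <= r -> 0 <= f x) ->
  0 <= \int[mu]_(x in `[l, r]) f x.
Proof. by move=> f0; apply: Rintegral_ge0 => x /=; rewrite in_itv/=; exact: f0. Qed.

End interval_integral.

Lemma Rintegral_interval_lb (R : realType) (l r a b c : R) (f : R -> R) :
  l <= a -> a <= b -> b <= r -> continuous f ->
  (forall x, l <= x <= r -> 0 <= f x) -> (forall x, a <= x <= b -> c <= f x) ->
  c * (b - a) <= \int[lebesgue_measure]_(x in `[l, r]) f x.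
Proof.
move=> la ab br cf f0 fc; rewrite -Rintegral_interval_cst//.
apply: (@le_trans _ _ (\int[lebesgue_measure]_(x in `[a, b]) f x)).
  by apply: Rintegral_interval_le => // x; exact: cvg_cst.
have sub : (`[a, b]%classic : set R) `<=` `[l, r]%classic.
  by apply: subset_itv; rewrite bnd_simp.
apply: fine_le.
- by apply: integrable_fin_num => //; exact: continuous_interval_integrable.
- by apply: integrable_fin_num => //; exact: continuous_interval_integrable.
apply: ge0_subset_integral => //.
exact: measurable_int (continuous_interval_integrable l r cf).
Qed.

(** * Gaussian integrals over an interval *)

Section gaussian_bounds.
Context (R : realType).
Implicit Types s x t : R.

Lemma gaussian_gt0 s x : 0 < gaussian s x.
Proof. exact: expR_gt0. Qed.

Lemma gaussian_le1 s x : gaussian s x <= 1.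
Proof.
rewrite /gaussian expR_le1 mulNr oppr_le0 mulr_ge0 ?sqr_ge0//.
by rewrite invr_ge0 mulr_ge0// sqr_ge0.
Qed.

Lemma continuous_gaussian s : continuous (gaussian s).
Proof.
move=> x; apply: (@continuous_comp _ _ _ (fun x => - x ^+ 2 / (2 * s ^+ 2)) expR).
  by apply: cvgMl; apply: cvgN; exact: exprn_continuous.
exact: continuous_expR.
Qed.

Lemma continuous_gaussian_shift s t : continuous (fun y => gaussian s (y - t)).
Proof.
move=> x; apply: (@continuous_comp _ _ _ (fun y => y - t) (gaussian s)).
  by apply: cvgB; [exact: cvg_id|exact: cvg_cst].
exact: continuous_gaussian.
Qed.

Lemma gaussian_ge_half s x : 0 < s -> `|x| <= s -> 2^-1 <= gaussian s x.
Proof.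
move=> s0 xs; rewrite /gaussian.
apply: le_trans (expR_ge1Dx _).
have x2 : x ^+ 2 <= s ^+ 2.
  by rewrite -real_normK ?num_real// lerXn2r ?nnegrE// ltW.
have : x ^+ 2 / (2 * s ^+ 2) <= 2^-1.
  by rewrite ler_pdivrMr ?mulr_gt0 ?exprn_gt0// mulrA mulVf// mul1r.
by rewrite mulNr; lra.
Qed.

Lemma pi_le4 : pi <= 4 :> R.
Proof. by have := pihalf_lt2 R; lra. Qed.

(** The normal law has total mass 1, so the integral is at most [s * sqrt (2 * pi)]; [pi <= 4]
    brings the constant below 3. *)
Lemma gaussian_integral_le s t l r : 0 < s ->
  \int[lebesgue_measure]_(y in `[l, r]) gaussian s (y - t) <= 3 * s.
Proof.
move=> s0; have s_neq0 : s != 0 by rewrite gt_eqF.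
have cg := @continuous_gaussian_shift s t.
have peak0 := normal_peak_gt0 s_neq0.
have gE y : normal_pdf t s y = normal_peak s * gaussian s (y - t).
  rewrite normal_pdfE// /normal_fun /gaussian; congr (_ * expR (_ / _)).
  by rewrite mulr_natl.
have : normal_peak s * \int[lebesgue_measure]_(y in `[l, r]) gaussian s (y - t) <= 1.
  rewrite -RintegralZl//; last exact: continuous_interval_integrable.
  under eq_Rintegral do rewrite -gE.
  rewrite -lee_fin -(integral_normal_pdf t s) /Rintegral fineK//; last first.
    apply: integrable_fin_num => //.
    apply: (integrableS measurableT) => //; exact: integrable_normal_pdf.
  apply: ge0_subset_integral => //.
    by apply/measurable_EFinP; exact: measurable_normal_pdf.
  by move=> x _; rewrite lee_fin normal_pdf_ge0.
rewrite mulrC -ler_pdivlMr// div1r => /le_trans; apply.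
have s3 : 0 <= 3 * s by rewrite mulr_ge0// ltW.
rewrite /normal_peak invrK -[leRHS]ger0_norm// -sqrtr_sqr.
rewrite ler_sqrt ?sqr_ge0// exprMn -mulr_natr.
have := sqr_ge0 s; have := pi_le4; nra.
Qed.

Lemma gaussian_integral_ge s t l r : 0 < s -> l <= t - s -> t + s <= r ->
  s <= \int[lebesgue_measure]_(y in `[l, r]) gaussian s (y - t).
Proof.
move=> s0 h1 h2; have E : s = 2^-1 * (t + s - (t - s)) by field.
rewrite [leLHS]E; apply: Rintegral_interval_lb => //; first by lra.
- exact: continuous_gaussian_shift.
- by move=> x _; rewrite ltW ?gaussian_gt0.
move=> x /andP[x1 x2]; apply: gaussian_ge_half => //.
by rewrite ler_norml; apply/andP; split; lra.
Qed.

(** The kernel of width [s] is the one of width [2 * s] times [expR (- x)] with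
    [x = 3 / 8 * (u ^+ 2 / s ^+ 2)]. As [x * expR (- x) <= 1], the factor [u ^+ 2] costs
    [8 / 3 * s ^+ 2], and the remaining mass is at most [6 * s]. *)
Lemma gaussian_second_moment_le s t l r : 0 < s ->
  \int[lebesgue_measure]_(y in `[l, r]) ((y - t) ^+ 2 * gaussian s (y - t))
  <= 16 * s ^+ 3.
Proof.
move=> s0; have s20 : 0 < 2 * s by rewrite mulr_gt0.
have -> : 16 * s ^+ 3 = (8 / 3 * s ^+ 2) * (3 * (2 * s)) by field.
have c0 : 0 <= 8 / 3 * s ^+ 2 by rewrite mulr_ge0// sqr_ge0.
apply: le_trans (ler_wpM2l c0 (gaussian_integral_le t l r s20)).
have cg2 := @continuous_gaussian_shift (2 * s) t.
rewrite -RintegralZl//; last exact: continuous_interval_integrable.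
apply: Rintegral_interval_le.
- move=> y; apply: cvgM; last exact: continuous_gaussian_shift.
  apply: (@continuous_comp _ _ _ (fun y => y - t) (fun z => z ^+ 2)).
    by apply: cvgB; [exact: cvg_id|exact: cvg_cst].
  exact: exprn_continuous.
- by move=> y; apply: cvgMr; exact: cg2.
move=> y _; move: (y - t) => u.
pose x := 3 / 8 * (u ^+ 2 / s ^+ 2).
have -> : gaussian s u = gaussian (2 * s) u * expR (- x).
  rewrite /gaussian -expRD; congr expR; rewrite /x; field.
  by rewrite gt_eqF.
rewrite mulrCA [leRHS]mulrC ler_wpM2l ?(ltW (gaussian_gt0 _ _))//.
have -> : u ^+ 2 = 8 / 3 * s ^+ 2 * x by rewrite /x; field; rewrite gt_eqF.
rewrite -(mulrA (8 / 3 * s ^+ 2)) ler_piMr//.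
have := expR_ge1Dx x; have := expRxMexpNx_1 x; have := expR_gt0 (- x).
nra.
Qed.

End gaussian_bounds.

(** * Moments and log-partition function of the truncated Gaussian *)

Section exponential_family.
Context (R : realType) (l r s : R).
Hypothesis lr : l < r.
Hypothesis s0 : 0 < s.
Implicit Types (p q : R -> R) (th c : R).
Notation mu := (@lebesgue_measure R).

(* The truncated Gaussian with mean parameter [th], rewritten as an exponential
   family: [gaussian s (y - th) = expR (- th ^+ 2 / (2 * s ^+ 2)) * tilt th y]. *)
Definition tilt (s th y : R) : R := expR ((y * th - y ^+ 2 / 2) / s ^+ 2).

Definition tilted_integral (l r s : R) (q : R -> R) (th : R) : R :=
  \int[mu]_(y in `[l, r]) (q y * tilt s th y).

Local Notation Z := (tilted_integral l r s).

Lemma tilt_gaussian th y :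
  tilt s th y = expR (th ^+ 2 / (2 * s ^+ 2)) * gaussian s (y - th).
Proof.
by rewrite /tilt /gaussian -expRD; congr expR; field; rewrite gt_eqF.
Qed.

Lemma continuous_tilt th : continuous (tilt s th).
Proof.
rewrite (_ : tilt s th = fun y =>
  expR (th ^+ 2 / (2 * s ^+ 2)) * gaussian s (y - th)); last first.
  by apply/funext => y; rewrite tilt_gaussian.
by move=> y; apply: cvgMr; exact: continuous_gaussian_shift.
Qed.

Lemma continuous_mul_tilt q th : continuous q ->
  continuous (fun y => q y * tilt s th y).
Proof. by move=> cq y; apply: cvgM; [exact: cq|exact: continuous_tilt]. Qed.

Lemma tilted_integral_gaussian q th : continuous q ->
  Z q th = expR (th ^+ 2 / (2 * s ^+ 2)) *
    \int[mu]_(y in `[l, r]) (q y * gaussian s (y - th)).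
Proof.
move=> cq; rewrite -RintegralZl//; last first.
  apply: continuous_interval_integrable => y.
  by apply: cvgM; [exact: cq|exact: continuous_gaussian_shift].
by apply: eq_Rintegral => y _; rewrite tilt_gaussian mulrCA.
Qed.

Lemma tilted_integralD p q th : continuous p -> continuous q ->
  Z (fun y => p y + q y) th = Z p th + Z q th.
Proof.
move=> cp cq; rewrite /tilted_integral -RintegralD//; last 2 first.
- exact/continuous_interval_integrable/continuous_mul_tilt.
- exact/continuous_interval_integrable/continuous_mul_tilt.
by apply: eq_Rintegral => y _; rewrite mulrDl.
Qed.

Lemma tilted_integralZ c q th : continuous q ->
  Z (fun y => c * q y) th = c * Z q th.
Proof.
move=> cq; rewrite /tilted_integral -RintegralZl//; last first.
  exact/continuous_interval_integrable/continuous_mul_tilt.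
by apply: eq_Rintegral => y _; rewrite mulrA.
Qed.

(** In this parametrization a derivative in [th] only multiplies the integrand by [y / s ^+ 2], so
    the weights [1], [y] and [y ^+ 2] suffice for the mean and its derivative. *)
Lemma is_derive_tilted_integral q th : continuous q ->
  is_derive th 1 (Z q) (Z (fun y => y * q y) th / s ^+ 2).
Proof.
move=> cq.
pose f x y := q y * tilt s x y.
have df (x y : R) : is_derive x 1 (f ^~ y) (q y * tilt s x y * (y / s ^+ 2)).
  rewrite /f /tilt; apply: is_derive_eq; rewrite /GRing.scale/=.
  by ring.
have d1f (x y : R) : partial1of2 f x y = q y * tilt s x y * (y / s ^+ 2).
  by rewrite partial1of2E; apply: derive_val.
(* Dominates the derivative for all parameters within 1 of [th]; the factor of [tilt] that is
   quadratic in [y] is bounded by 1. *)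
pose G y := `|q y * (y / s ^+ 2)| * expR ((`|y| * (`|th| + 1)) / s ^+ 2).
have cG : continuous G.
  move=> y; apply: cvgM.
    apply: cvg_norm; apply: cvgM; first exact: cq.
    by apply: cvgMl; exact: cvg_id.
  apply: (@continuous_comp _ _ _ (fun y => `|y| * (`|th| + 1) / s ^+ 2) expR).
    by do 2 apply: cvgMl; apply: cvg_norm; exact: cvg_id.
  exact: continuous_expR.
have Ia : `]th - 1, th + 1[%classic th by rewrite /= in_itv/=; lra.
have if_ (x : R) : `]th - 1, th + 1[%classic x -> mu.-integrable `[l, r] (EFin \o f x).
  by move=> _; exact/continuous_interval_integrable/continuous_mul_tilt.
have dd (x y : R) : `]th - 1, th + 1[%classic x -> `[l, r]%classic y ->
    derivable (f ^~ y) x 1.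
  by move=> _ _; apply: ex_derive.
have G0 y : 0 <= G y by rewrite mulr_ge0// expR_ge0.
have Gub (x y : R) : `]th - 1, th + 1[%classic x -> `[l, r]%classic y ->
    `|partial1of2 f x y| <= G y.
  rewrite /= in_itv/= => /andP[x1 x2] _; rewrite d1f.
  rewrite mulrAC normrM /G ler_wpM2l// ger0_norm ?expR_ge0// ler_expR.
  rewrite ler_wpM2r ?invr_ge0 ?sqr_ge0//.
  have xth : `|x| <= `|th| + 1.
    rewrite -[x](subrKC th) (le_trans (ler_normD _ _))// lerD2l ler_norml.
    by apply/andP; split; lra.
  have : y * x <= `|y| * (`|th| + 1).
    by rewrite (le_trans (ler_norm _))// normrM ler_wpM2l.
  by have := sqr_ge0 y; lra.
have iG : mu.-integrable `[l, r] (EFin \o G) by exact: continuous_interval_integrable.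
have mI : measurable (`[l, r]%classic : set (measurableTypeR R)) by [].
apply: DeriveDef.
  have H := derivable_under_integral mI Ia if_ dd G0 iG Gub.
  exact: H.
rewrite -derive1E (differentiation_under_integral mI Ia if_ dd G0 iG Gub).
rewrite /tilted_integral mulrC -RintegralZl//; last first.
  apply/continuous_interval_integrable/continuous_mul_tilt => y.
  by apply: cvgM; [exact: cvg_id|exact: cq].
by apply: eq_Rintegral => y _; rewrite d1f; ring.
Qed.

Lemma tilted_integral_gt0 q th : continuous q ->
  (forall y, l <= y <= r -> 0 <= q y) ->
  forall a b c, l <= a -> a < b -> b <= r -> 0 < c ->
  (forall y, a <= y <= b -> c <= q y) -> 0 < Z q th.
Proof.
move=> cq q0 a b c la ab br c0 qc.
pose B := `|a| + `|b|.
pose e := expR (- (B * `|th| + B ^+ 2 / 2) / s ^+ 2).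
apply: (@lt_le_trans _ _ (c * e * (b - a))).
  by rewrite !mulr_gt0// ?expR_gt0// subr_gt0.
apply: Rintegral_interval_lb => //; first exact: ltW.
- exact: continuous_mul_tilt.
- by move=> y ylr; rewrite mulr_ge0 ?expR_ge0// q0.
move=> y yab; rewrite ler_pM ?expR_ge0 ?qc ?ler_expR ?(ltW c0)//.
rewrite ler_wpM2r ?invr_ge0 ?sqr_ge0//.
have yB : `|y| <= B.
  move: yab => /andP[ay yb]; rewrite /B ler_norml; apply/andP; split.
    by have := ler_norm (- a); rewrite normrN; have := normr_ge0 b; lra.
  by have := ler_norm b; have := normr_ge0 a; lra.
have h1 : - (y * th) <= B * `|th|.
  by rewrite (le_trans (ler_norm _))// normrN normrM ler_wpM2r.
have h2 : y ^+ 2 <= B ^+ 2.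
  by rewrite -real_normK ?num_real// lerXn2r ?nnegrE// addr_ge0.
by lra.
Qed.

Let c1 : continuous (fun _ : R => 1 : R). Proof. by move=> y; exact: cvg_cst. Qed.
Let cid : continuous (id : R -> R). Proof. by move=> y; exact: cvg_id. Qed.
Let csqr : continuous (fun y : R => y * y).
Proof. by move=> y; apply: cvgM; exact: cvg_id. Qed.
Let csqrB m : continuous (fun y : R => (y - m) ^+ 2).
Proof.
move=> x; apply: (@continuous_comp _ _ _ (fun y => y - m) (fun z => z ^+ 2)).
  by apply: cvgB; [exact: cvg_id|exact: cvg_cst].
exact: exprn_continuous.
Qed.

Definition tilted_mean (l r s th : R) : R :=
  tilted_integral l r s id th / tilted_integral l r s (fun=> 1) th.

Definition tilted_var (l r s th : R) : R :=
  tilted_integral l r s (fun y => (y - tilted_mean l r s th) ^+ 2) th /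
  tilted_integral l r s (fun=> 1) th.

Local Notation mean := (tilted_mean l r s).
Local Notation var := (tilted_var l r s).

Lemma tilted_integral1_gt0 th : 0 < Z (fun=> 1) th.
Proof. by apply: (@tilted_integral_gt0 _ th c1 _ l r 1). Qed.

(** Wherever the mean is, one of the two outer quarters of the interval stays at distance at least
    [(r - l) / 4] from it. *)
Lemma tilted_var_gt0 th : 0 < var th.
Proof.
rewrite divr_gt0 ?tilted_integral1_gt0//; set m := mean th.
have q0 y : l <= y <= r -> 0 <= (y - m) ^+ 2 by move=> _; exact: sqr_ge0.
pose c := (r - l) / 4.
have c0 : 0 < c by rewrite divr_gt0// subr_gt0.
have c2 : 0 < c ^+ 2 by rewrite exprn_gt0.
have cE : r - l = 4 * c by rewrite /c; field.
have [ml|ml] := leP m (l + 2 * c).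
  apply: (@tilted_integral_gt0 _ th (@csqrB m) q0 (l + 3 * c) r (c ^+ 2)) => //; try by lra.
  by move=> y /andP[y1 y2]; rewrite lerXn2r ?nnegrE//; lra.
apply: (@tilted_integral_gt0 _ th (@csqrB m) q0 l (l + c) (c ^+ 2)) => //; try by lra.
move=> y /andP[y1 y2]; rewrite -(sqrrN (y - m)).
by rewrite lerXn2r ?nnegrE//; lra.
Qed.

(** The derivative of the mean in the natural parameter [th / s ^+ 2] is the variance. *)
Lemma is_derive_tilted_mean th : is_derive th 1 mean (var th / s ^+ 2).
Proof.
have Z0 := tilted_integral1_gt0 th.
have d0 : is_derive th 1 (Z (fun=> 1)) (Z id th / s ^+ 2).
  have -> : id = fun y => y * 1 :> R by apply/funext => y; rewrite mulr1.
  exact: is_derive_tilted_integral.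
have d1 := is_derive_tilted_integral th cid.
have dV : is_derive th 1 (fun x => (Z (fun=> 1) x)^-1)
    (- (Z (fun=> 1) th) ^- 2 *: (Z id th / s ^+ 2)).
  by apply: is_deriveV; rewrite gt_eqF.
apply: is_derive_eq.
rewrite /var -[mean th]/(Z id th / Z (fun=> 1) th).
have -> : Z (fun y => (y - Z id th / Z (fun=> 1) th) ^+ 2) th =
    Z (fun y => y * id y) th - (Z id th) ^+ 2 / Z (fun=> 1) th.
  set m := Z id th / _.
  have -> : (fun y => (y - m) ^+ 2) =
      fun y => y * y + ((- (2 * m)) * id y + m ^+ 2 * 1).
    by apply/funext => y /=; ring.
  rewrite tilted_integralD//; last first.
    move=> y; apply: cvgD; first by apply: cvgMr; exact: cvg_id.
    exact: cvg_cst.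
  rewrite tilted_integralD//; last 2 first.
  - by move=> y; apply: cvgMr; exact: cvg_id.
  - by move=> y; exact: cvg_cst.
  by rewrite !tilted_integralZ// /m; field; rewrite gt_eqF.
by rewrite /GRing.scale/=; field; rewrite !gt_eqF.
Qed.

Lemma is_derive_ln_tilted_integral th :
  is_derive th 1 (fun x => ln (Z (fun=> 1) x)) (mean th / s ^+ 2).
Proof.
have Z0 := tilted_integral1_gt0 th.
have d0 : is_derive th 1 (Z (fun=> 1)) (Z id th / s ^+ 2).
  have -> : id = fun y => y * 1 :> R by apply/funext => y; rewrite mulr1.
  exact: is_derive_tilted_integral.
have dl := is_derive1_ln Z0.
have := is_derive1_comp dl d0.
by rewrite /comp => h; apply: is_derive_eq; rewrite /tilted_mean/=; ring.
Qed.

End exponential_family.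

(** * Quantitative inversion of a function with a slope bound *)

Section increasing_inverse.
Context (R : realType) (f df : R -> R).
Hypothesis fdf : forall x : R, is_derive x 1 f (df x).

Lemma derive_continuous : continuous f.
Proof.
by move=> x; apply/differentiable_continuous/derivable1_diffP/ex_derive.
Qed.

Lemma derive_MVT a b : a < b ->
  exists2 c, a < c < b & f b - f a = df c * (b - a).
Proof.
move=> ab; have [c] := MVT ab (fun x _ => fdf x)
  (continuous_subspaceT derive_continuous).
by rewrite in_itv/= => cab ->; exists c.
Qed.

Lemma derive_gt0_increasing a b : (forall x, 0 < df x) -> a < b -> f a < f b.
Proof.
move=> df0 ab; have [c _ fE] := derive_MVT ab.
by rewrite -subr_gt0 fE mulr_gt0// subr_gt0.
Qed.

(** Over a step [dl] to either side of [c], [f] moves by at least [k * dl], so the intermediate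
    value theorem reaches [y]. It yields the limit [p] near [phi0], and again the preimages near
    [p]. *)
Lemma derive_lb_inverse c tau k y : 0 < k ->
  (forall x, `|x - c| <= tau -> k <= df x) -> `|y - f c| <= k * tau ->
  exists2 x, f x = y & `|x - c| <= k^-1 * `|y - f c|.
Proof.
move=> k0 hdf hy.
pose dl := k^-1 * `|y - f c|.
have dl0 : 0 <= dl by rewrite mulr_ge0// invr_ge0 ltW.
have kdl : k * dl = `|y - f c| by rewrite /dl mulrA divff ?mul1r// gt_eqF.
have dltau : dl <= tau by rewrite -(ler_pM2l k0) kdl.
move: dl0; rewrite le_eqVlt => /predU1P[dl0|dl0].
  exists c; last by rewrite subrr normr0 mulr_ge0// invr_ge0 ltW.
  by apply/eqP; rewrite eq_sym -subr_eq0 -normr_eq0 -kdl -dl0 mulr0.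
have [c1 /andP[c11 c12] e1] : exists2 x, c < x < c + dl &
  f (c + dl) - f c = df x * (c + dl - c) by apply: derive_MVT; lra.
have [c2 /andP[c21 c22] e2] : exists2 x, c - dl < x < c &
  f c - f (c - dl) = df x * (c - (c - dl)) by apply: derive_MVT; lra.
have d1 : k <= df c1 by apply: hdf; rewrite ler_norml; apply/andP; split; lra.
have d2 : k <= df c2 by apply: hdf; rewrite ler_norml; apply/andP; split; lra.
have h1 : k * dl <= f (c + dl) - f c by rewrite e1; nra.
have h2 : k * dl <= f c - f (c - dl) by rewrite e2; nra.
have ab : c - dl <= c + dl by lra.
have yb : f (c - dl) <= y <= f (c + dl).
  by have := lexx `|y - f c|; rewrite ler_norml => /andP[? ?]; apply/andP; split; lra.
have fmono : f (c - dl) <= f (c + dl) by case/andP: yb => ? ?; lra.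
have := IVT (f := f) (v := y) ab (continuous_subspaceT derive_continuous).
rewrite (min_idPl fmono) (max_idPr fmono) => /(_ yb)[x].
rewrite in_itv/= => /andP[x1 x2] fx; exists x => //.
by rewrite -/dl ler_norml; apply/andP; split; lra.
Qed.

(** Differentiability of the inverse at [f p], in the form that the delta method consumes. Keeping
    [p] within [tau / 2] of [c] leaves room for the slope bound around [p]. *)
Lemma derive_inverse_linearized c tau k p : 0 < k -> 0 < tau ->
  (forall x, `|x - c| <= tau -> k <= df x) -> `|p - c| <= tau / 2 ->
  forall e, 0 < e -> exists2 dl, 0 < dl & forall y, `|y - f p| <= dl ->
  exists2 x, f x = y & `|x - p - (df p)^-1 * (y - f p)| <= e * `|y - f p| /\
    `|x - c| <= tau.
Proof.
move=> k0 tau0 hdf pc e e0.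
have hdfp x : `|x - p| <= tau / 2 -> k <= df x.
  move=> xp; apply: hdf; rewrite -[x](subrK p) -addrA.
  by rewrite (le_trans (ler_normD _ _))//; lra.
have dfp : 0 < df p.
  by apply: (lt_le_trans k0); apply: hdfp; rewrite subrr normr0 divr_ge0 ?ltW.
(* This precision becomes [e] after division by [df p] and the estimate
   [|x - p| <= |y - f p| / k]. *)
have e1 : 0 < e * df p * k by rewrite !mulr_gt0.
have [rho rho0 hrho] : exists2 rho, 0 < rho & forall x, `|x - p| < rho ->
    `|f x - f p - df p * (x - p)| <= e * df p * k * `|x - p|.
  have hq : h^-1 *: ((f \o shift p) (h *: 1) - f p) @[h --> 0^'] --> df p.
    have <- : 'D_1 f p = df p by apply: derive_val.
    have h : derivable f p 1 by apply: ex_derive.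
    exact: h.
  move: hq => /cvgrPdist_le/(_ _ e1); rewrite near_withinE /=.
  move=> /nbhs_ballP[rho /= rho0 hrho]; exists rho => // x xp.
  have [->|xnp] := eqVneq x p; first by rewrite !subrr mulr0 subrr normr0 mulr0.
  have := hrho (x - p); rewrite /ball/= sub0r normrN => /(_ xp).
  rewrite subr_eq0 => /(_ xnp).
  rewrite /GRing.scale/= mulr1 subrK => h.
  have xp0 : x - p != 0 by rewrite subr_eq0.
  have -> : f x - f p - df p * (x - p) =
      - ((df p - (x - p)^-1 * (f x - f p)) * (x - p)) by field.
  by rewrite normrN normrM ler_wpM2r.
exists (k * Num.min (tau / 2) (rho / 2)).
  by rewrite mulr_gt0// lt_min !divr_gt0.
move=> y hy.
have [|x fx xp] := @derive_lb_inverse p (tau / 2) k y k0 hdfp.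
  by rewrite (le_trans hy)// ler_wpM2l ?(ltW k0)// ge_min lexx.
have xp2 : `|x - p| <= Num.min (tau / 2) (rho / 2).
  by rewrite (le_trans xp)// -(ler_pM2l k0) mulrA divff ?gt_eqF// mul1r.
move: xp2; rewrite le_min => /andP[xp2 xp3].
exists x => //; split; last first.
  rewrite -[x](subrK p) -addrA (le_trans (ler_normD _ _))//.
  by lra.
have := hrho x; have -> : `|x - p| < rho by lra.
move=> /(_ isT); rewrite fx => h.
have -> : x - p - (df p)^-1 * (y - f p) =
    - ((df p)^-1 * (y - f p - df p * (x - p))) by field; rewrite gt_eqF.
rewrite normrN normrM normfV (gtr0_norm dfp) mulrC ler_pdivrMr//.
apply: (le_trans h); rewrite [leRHS]mulrAC -(mulrA (e * df p)).
apply: ler_wpM2l; first by rewrite ltW// mulr_gt0.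
by rewrite -ler_pdivlMl.
Qed.

End increasing_inverse.

Section tilted_mean_theory.
Context (R : realType) (l r s : R).
Hypothesis lr : l < r.
Hypothesis s0 : 0 < s.

(** One of [[th - s, th - s / 2]] and [[th + s / 2, th + s]] is at distance at least [s / 2] from
    the mean. With kernel at least [1 / 2] there, it contributes [s ^+ 3 / 16], against a total mass
    of at most [3 * s]. *)
Lemma tilted_var_ge th : l <= th - s -> th + s <= r ->
  s ^+ 2 / 48 <= tilted_var l r s th.
Proof.
move=> h1 h2; rewrite /tilted_var; set m := tilted_mean l r s th.
have cB : continuous (fun y : R => (y - m) ^+ 2).
  move=> x; apply: (@continuous_comp _ _ _ (fun y => y - m) (fun z => z ^+ 2)).
    by apply: cvgB; [exact: cvg_id|exact: cvg_cst].
  exact: exprn_continuous.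
rewrite !tilted_integral_gaussian//; last by move=> y; exact: cvg_cst.
set ee := expR _; have e0 : 0 < ee by exact: expR_gt0.
rewrite invfM mulrACA divff ?gt_eqF// mul1r.
have g1 := gaussian_integral_le th l r s0.
set I1 := \int[_]_(y in _) _ in g1.
have -> : \int[lebesgue_measure]_(y in `[l, r]) (1 * gaussian s (y - th)) = I1.
  by apply: eq_Rintegral => y _; rewrite mul1r.
have cg := @continuous_gaussian_shift R s th.
have I1_gt0 : 0 < I1.
  exact: lt_le_trans (gaussian_integral_ge s0 h1 h2).
have cBg : continuous (fun y => (y - m) ^+ 2 * gaussian s (y - th)).
  by move=> y; apply: cvgM; [exact: cB|exact: cg].
have key a : l <= a -> a + s / 2 <= r -> (forall y, a <= y <= a + s / 2 ->
    `|y - th| <= s /\ s ^+ 2 / 4 <= (y - m) ^+ 2) ->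
    s ^+ 3 / 16 <= \int[lebesgue_measure]_(y in `[l, r]) ((y - m) ^+ 2 * gaussian s (y - th)).
  move=> la ar hya.
  have -> : s ^+ 3 / 16 = (s ^+ 2 / 4 * 2^-1) * (a + s / 2 - a) by field.
  apply: Rintegral_interval_lb => //; first by lra.
    by move=> y _; rewrite mulr_ge0 ?sqr_ge0// ltW ?gaussian_gt0.
  move=> y /hya[y1 y2]; apply: ler_pM => //; first by rewrite divr_ge0 ?sqr_ge0.
  exact: gaussian_ge_half.
rewrite ler_pdivlMr//; apply: (@le_trans _ _ (s ^+ 3 / 16)).
  have -> : s ^+ 3 / 16 = s ^+ 2 / 48 * (3 * s) by field.
  by rewrite ler_wpM2l// divr_ge0// sqr_ge0.
have sE : s ^+ 2 / 4 = (s / 2) ^+ 2 by field.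
have [mth|mth] := leP m th.
  apply: (key (th + s / 2)); [lra|lra|] => y /andP[y1 y2]; split.
    by rewrite ler_norml; apply/andP; split; lra.
  by rewrite sE lerXn2r ?nnegrE//; lra.
apply: (key (th - s)); [lra|lra|] => y /andP[y1 y2]; split.
  by rewrite ler_norml; apply/andP; split; lra.
by rewrite sE -(sqrrN (y - m)) lerXn2r ?nnegrE//; lra.
Qed.

(** The derivative is [(xbar - tilted_mean l r s t) / s ^+ 2], and the mean is strictly increasing,
    so its sign changes only at [thh]. *)
Lemma tilted_likelihood_max xbar thh : tilted_mean l r s thh = xbar ->
  forall th, th != thh ->
  xbar * th / s ^+ 2 - ln (tilted_integral l r s (fun=> 1) th) <
  xbar * thh / s ^+ 2 - ln (tilted_integral l r s (fun=> 1) thh).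
Proof.
move=> hx th; set J := fun t => xbar * t / s ^+ 2 - ln (tilted_integral l r s (fun=> 1) t).
rewrite -/(J th) -/(J thh).
have dJ (t : R) : is_derive t 1 J ((xbar - tilted_mean l r s t) / s ^+ 2).
  have dl := is_derive_ln_tilted_integral lr s0 t.
  rewrite /J; apply: is_derive_eq; rewrite /GRing.scale/=; ring.
have mono a b : a < b -> tilted_mean l r s a < tilted_mean l r s b.
  apply: derive_gt0_increasing; first exact: is_derive_tilted_mean.
  by move=> x; rewrite divr_gt0 ?exprn_gt0// tilted_var_gt0.
have s20 : 0 < s ^+ 2 by rewrite exprn_gt0.
rewrite neq_lt => /orP[tt|tt]; have [c /andP[c1 c2] cE] := derive_MVT dJ tt.
  rewrite -subr_gt0 cE !mulr_gt0 ?invr_gt0// ?subr_gt0//.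
  by rewrite -hx mono.
rewrite -subr_lt0 cE pmulr_llt0 ?subr_gt0// pmulr_llt0 ?invr_gt0// subr_lt0.
by rewrite -hx mono.
Qed.

End tilted_mean_theory.

(** * The sampling density on the window *)

Section principal_angle_theory.
Context (R : realType).
Implicit Types x phi : R.

(** Distance on the circle for [|x - phi| <= 2 * pi]. Unlike [principal_angle] it has no jump, so
    the kernel becomes a continuous function of [x]. *)
Definition arc_distance phi x : R := Num.min `|x - phi| (2 * pi - `|x - phi|).

Lemma principal_angle_shift (k : int) x :
  - pi <= x - 2 * pi * k%:~R < pi -> principal_angle x = x - 2 * pi * k%:~R.
Proof.
move=> /andP[h1 h2]; have p0 := pi_gt0 R.
have p20 : 0 < 2 * pi :> R by lra.
rewrite /principal_angle (@floor_def _ _ k)//.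
rewrite intrD1 ler_pdivlMr// ltr_pdivrMr//; apply/andP; split; lra.
Qed.

Lemma norm_principal_angle phi x : `|x - phi| <= 2 * pi ->
  `|principal_angle (x - phi)| = arc_distance phi x.
Proof.
rewrite /arc_distance; move: (x - phi) => u; have p0 := pi_gt0 R.
rewrite ler_norml => /andP[u1 u2].
have [h1|h1] := ltP u (- pi).
  rewrite (@principal_angle_shift (-1)) ?mulrN1z; last by apply/andP; split; lra.
  rewrite mulrN mulr1 opprK (ltr0_norm (_ : u < 0)); last by lra.
  rewrite ger0_norm; last by lra.
  by rewrite min_r; lra.
have [h2|h2] := ltP u pi.
  rewrite (@principal_angle_shift 0) ?mulr0 ?subr0; last by apply/andP; split; lra.
  rewrite min_l//; have : `|u| <= pi by rewrite ler_norml; apply/andP; split; lra.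
  lra.
rewrite (@principal_angle_shift 1) ?mulr1; last by apply/andP; split; lra.
rewrite (ger0_norm (_ : 0 <= u)); last by lra.
rewrite ler0_norm; last by lra.
by rewrite min_r; lra.
Qed.

Lemma continuous_arc_distance phi : continuous (arc_distance phi).
Proof.
move=> x; have cn : continuous (fun x => `|x - phi|).
  by move=> y; apply: cvg_norm; apply: cvgB; [exact: cvg_id|exact: cvg_cst].
apply: (@continuous_min _ _ (fun x => `|x - phi|) (fun x => 2 * pi - `|x - phi|)).
  exact: cn.
by apply: cvgB; [exact: cvg_cst|exact: cn].
Qed.

Lemma gaussian_norm (s u : R) : gaussian s `|u| = gaussian s u.
Proof. by rewrite /gaussian real_normK ?num_real. Qed.

Definition gauss_mass (s : R) : R :=
  \int[lebesgue_measure]_(y in `]- pi, pi[) gaussian s y.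

Lemma gauss_kernelE (s : R) phi x : `|x - phi| <= 2 * pi ->
  gauss_kernel s (x - phi) = gaussian s (arc_distance phi x) / gauss_mass s.
Proof. by move=> h; rewrite -norm_principal_angle// gaussian_norm. Qed.

Lemma gauss_massE (s : R) :
  gauss_mass s = \int[lebesgue_measure]_(y in `[- pi, pi]) gaussian s (y - 0).
Proof.
have i0 := continuous_interval_integrable (- pi) pi (@continuous_gaussian R s).
have p0 := pi_gt0 R.
rewrite /gauss_mass Rintegral_itv_bndo_bndc; last first.
  apply: integrableS i0 => //.
  by apply: subset_itv; rewrite bnd_simp.
rewrite Rintegral_itv_obnd_cbnd; last first.
  apply: integrableS i0 => //.
  by apply: subset_itv; rewrite bnd_simp.
by apply: eq_Rintegral => y _; rewrite subr0.
Qed.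

Lemma gauss_mass_le (s : R) : 0 < s -> gauss_mass s <= 3 * s.
Proof. by move=> s0; rewrite gauss_massE; exact: gaussian_integral_le. Qed.

Lemma gauss_mass_gt0 (s : R) : 0 < s -> 0 < gauss_mass s.
Proof.
move=> s0; rewrite gauss_massE; have p0 := pi_gt0 R.
pose a := Num.min s pi; have a0 : 0 < a by rewrite lt_min s0.
apply: (@lt_le_trans _ _ (2^-1 * (a - 0))); first by rewrite subr0 mulr_gt0.
apply: Rintegral_interval_lb => //.
- lra.
- exact: ltW.
- by rewrite ge_min lexx orbT.
- exact: continuous_gaussian_shift.
- by move=> x _; rewrite ltW ?gaussian_gt0.
move=> x /andP[x1 x2]; apply: gaussian_ge_half => //.
rewrite subr0 ger0_norm// (le_trans x2)//.
by rewrite ge_min lexx.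
Qed.

(** From a phase outside the window, each way round the circle enters through one end; [A1] and [A2]
    are the lengths of the two ways up to [l] and [r]. The bounds on [l] and [r] keep the way
    through 0 longer than [m] as well. *)
Lemma arc_distance_tent (l r phi m : R) : 0 <= m -> 0 <= phi < 2 * pi ->
  (phi <= l - m) || (r + m <= phi) -> m <= l -> r + m <= 2 * pi ->
  exists A1 A2, [/\ m <= A1, m <= A2 & forall x, l <= x <= r ->
    `|x - phi| <= 2 * pi /\
    arc_distance phi x = Num.min (A1 + (x - l)) (A2 + (r - x))].
Proof.
move=> m0 /andP[p1 p2] /orP[pl|pr] ml rm.
  exists (l - phi), (phi + 2 * pi - r); split; [lra|lra|] => x /andP[x1 x2].
  rewrite /arc_distance ger0_norm; last by lra.
  by split; [lra|congr (Num.min _ _); lra].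
exists (2 * pi - phi + l), (phi - r); split; [lra|lra|] => x /andP[x1 x2].
rewrite /arc_distance ler0_norm; last by lra.
by split; [lra|rewrite minC; congr (Num.min _ _); lra].
Qed.

End principal_angle_theory.

(** The density [f] is only controlled on the window; [p] is a continuous function that agrees with
    it there, extended by zero to give a nonnegative weight. *)
Lemma Rexp_density d (T : measurableType d) (R : realType) (Pr : probability T R)
    (Y : {RV Pr >-> R}) (l r : R) (f p h : R -> R) :
  has_density_on Y `[l, r] f -> continuous p ->
  (forall x, l <= x <= r -> f x = p x) -> (forall x, l <= x <= r -> 0 <= p x) ->
  bounded_measurable h -> continuous h -> (forall x, 0 <= h x) ->
  \int[Pr]_w h (Y w) = \int[lebesgue_measure]_(x in `[l, r]) (h x * p x).
Proof.
move=> hY cp fp p0 mh ch h0.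
pose q := p \_ `[l, r].
have q0 x : 0 <= q x.
  by rewrite /q patchE; case: ifPn => //; rewrite inE/= in_itv/= => /p0.
have mp : measurable_fun setT (p : measurableTypeR R -> R).
  exact: continuous_measurable_fun.
have mq : measurable_fun setT (q : measurableTypeR R -> R).
  by rewrite /q; apply/(measurable_restrictT _ _).1 => //; exact: measurable_funTS.
have mid : measurable_fun setT (id : measurableTypeR R -> R) by [].
have hmE : measurable_fun setT (fun y => (h y)%:E).
  by apply/measurable_EFinP; exact: mh.1.
have nuE A : measurable A -> distribution Pr Y A =
    (\int[lebesgue_measure]_(x in id @^-1` A) (q x)%:E)%E.
  move=> mA; rewrite hY// integral_mkcondr; apply: eq_integral => x _.
  rewrite /q !patchE; case: ifPn => //; rewrite inE/= in_itv/= => xlr.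
  by rewrite fp.
have := ge0_integral_weighted mid mq q0 nuE hmE.
have h0' y : (0 <= (h y)%:E)%E by rewrite lee_fin.
move=> /(_ h0'); rewrite /distribution ge0_integral_pushforward//=.
rewrite preimage_setT /Rintegral => ->; congr fine.
rewrite [RHS]integral_mkcond; apply: eq_integral => x _.
rewrite /q !patchE -EFinM; case: ifPn => //.
by rewrite mulr0.
Qed.

(** * Signal and leakage inside the window *)

Section window_density.
Context (R : realType) (n : nat) (a phi : 'I_n.+1 -> R) (l r Delta s : R).
Hypothesis s0 : 0 < s.
Hypothesis a_ge0 : forall j, 0 <= a j.
Hypothesis a_sum : \sum_j a j <= 1.
Hypothesis phi_itv : forall j, 0 <= phi j < 2 * pi.
Hypothesis Delta0 : 0 < Delta.
Hypothesis gap : forall j, j != ord0 ->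
  phi j < phi ord0 - Delta \/ phi ord0 + Delta < phi j.
Hypothesis inner_l : l <= phi ord0 - Delta / 6.
Hypothesis inner_r : phi ord0 + Delta / 6 <= r.
Hypothesis lr : r - l = Delta.
Hypothesis outer_l : 0 <= phi ord0 - Delta.
Hypothesis outer_r : phi ord0 + Delta < 2 * pi.
Notation phi0 := (phi ord0).

Local Ltac window_facts :=
  move: s0 inner_l inner_r lr outer_l outer_r Delta0 => ? ? ? ? ? ? ?.

Definition leakage (s x : R) : R :=
  \sum_(j | j != ord0) a j * gaussian s (arc_distance (phi j) x).

Lemma continuous_sum_fun (I : Type) (rr : seq I) (P : pred I) (F : I -> R -> R) :
  (forall i, continuous (F i)) -> continuous (fun x => \sum_(i <- rr | P i) F i x).
Proof.
move=> cF; elim: rr => [|i rr IH].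
  rewrite (_ : (fun x => _) = fun=> 0); first by move=> x; exact: cvg_cst.
  by apply/funext => y; rewrite big_nil.
rewrite (_ : (fun x => _) =
  fun y => (if P i then F i y else 0) + \sum_(j <- rr | P j) F j y); last first.
  by apply/funext => y; rewrite big_cons; case: ifP => //; rewrite add0r.
move=> x; apply: cvgD; last exact: IH.
by case: (P i); [exact: cF|exact: cvg_cst].
Qed.

Lemma continuous_leakage : continuous (leakage s).
Proof.
apply: continuous_sum_fun => j x; apply: cvgMr.
apply: (@continuous_comp _ _ _ (arc_distance (phi j)) (gaussian s)).
  exact: continuous_arc_distance.
exact: continuous_gaussian.
Qed.

Lemma gaussian_nonincreasing u v : 0 <= u -> u <= v -> gaussian s v <= gaussian s u.
Proof.
move=> u0 uv; rewrite ler_expR.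
apply: ler_wpM2r; first by rewrite invr_ge0 mulr_ge0 ?sqr_ge0.
by rewrite lerN2 lerXn2r ?nnegrE// (le_trans u0).
Qed.

(** The window extends at most [5 / 6 * Delta] from [phi0] while the other phases are beyond
    [Delta], which leaves [Delta / 6]. [outer_l] and [outer_r] ensure the same across 0. *)
Lemma leakage_bounds x : l <= x <= r -> 0 <= leakage s x <= gaussian s (Delta / 6).
Proof.
move=> xlr; window_facts; apply/andP; split.
  by apply: sumr_ge0 => j _; rewrite mulr_ge0// ltW ?gaussian_gt0.
apply: (@le_trans _ _ (\sum_(j | j != ord0) a j * gaussian s (Delta / 6))).
  apply: ler_sum => j j0; rewrite ler_wpM2l//.
  have [|||||A1 [A2 [h1 h2 h3]]] := @arc_distance_tent R l r (phi j) (Delta / 6).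
  - by rewrite divr_ge0// ltW.
  - exact: phi_itv.
  - by have [h|h] := gap j0; apply/orP; [left|right]; lra.
  - by lra.
  - by lra.
  have [_ ->] := h3 _ xlr; apply: gaussian_nonincreasing; first by rewrite divr_ge0// ltW.
  by rewrite le_min; move: xlr => /andP[? ?]; apply/andP; split; lra.
rewrite -mulr_suml ler_piMl ?(ltW (gaussian_gt0 _ _))//.
rewrite (le_trans _ a_sum)// [leRHS](bigID (fun j => j != ord0))/= lerDl.
exact: sumr_ge0.
Qed.

(** The factor [gauss_mass] is left out: it cancels in the filtered density and only matters for the
    retained fraction. *)
Definition target_density (s x : R) : R :=
  a ord0 * gaussian s (x - phi0) + leakage s x.

Definition target_mass (s : R) : R :=
  \int[lebesgue_measure]_(x in `[l, r]) target_density s x.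

Lemma continuous_target_density : continuous (target_density s).
Proof.
move=> x; apply: cvgD; last exact: continuous_leakage.
by apply: cvgMr; exact: continuous_gaussian_shift.
Qed.

Lemma target_density_ge0 x : l <= x <= r -> 0 <= target_density s x.
Proof.
move=> xlr; rewrite addr_ge0 ?mulr_ge0 ?(ltW (gaussian_gt0 _ _))//.
by have /andP[] := leakage_bounds xlr.
Qed.

Lemma sample_densityE x : l <= x <= r ->
  sample_density a phi s x = target_density s x / gauss_mass s.
Proof.
move=> /andP[x1 x2]; window_facts.
have near j : `|x - phi j| <= 2 * pi.
  by have /andP[? ?] := phi_itv j; rewrite ler_norml; apply/andP; split; lra.
rewrite /sample_density (bigD1 ord0)//= /target_density /leakage.
rewrite mulrDl mulr_suml; congr (_ + _).
  rewrite gauss_kernelE// mulrA -(gaussian_norm s (x - phi0)); congr (_ * gaussian _ _ / _).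
  by rewrite /arc_distance min_l//; have : `|x - phi0| <= Delta;
    [rewrite ler_norml; apply/andP; split; lra|lra].
by apply: eq_bigr => j _; rewrite gauss_kernelE// mulrA.
Qed.

Lemma retained_fractionE :
  retained_fraction a phi s `[l, r] = target_mass s / gauss_mass s.
Proof.
rewrite /target_mass -RintegralZr//; last first.
  exact/continuous_interval_integrable/continuous_target_density.
by apply: eq_Rintegral => x; rewrite inE/= in_itv/= => /sample_densityE.
Qed.

Lemma filtered_densityE x : l <= x <= r ->
  filtered_density a phi s `[l, r] x = target_density s x / target_mass s.
Proof.
move=> xlr; rewrite /filtered_density sample_densityE// retained_fractionE.
have N0 := gauss_mass_gt0 s0.
by rewrite invfM invrK mulrACA mulVf ?mulr1// gt_eqF.
Qed.

Hypothesis s_small : s <= Delta / 6.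

Let phi0_l : l <= phi0 - s.
Proof. by window_facts; move: s_small => ?; lra. Qed.
Let phi0_r : phi0 + s <= r.
Proof. by window_facts; move: s_small => ?; lra. Qed.

Lemma target_integralE (h : R -> R) : continuous h ->
  \int[lebesgue_measure]_(x in `[l, r]) (h x * target_density s x) =
  a ord0 * \int[lebesgue_measure]_(x in `[l, r]) (h x * gaussian s (x - phi0)) +
  \int[lebesgue_measure]_(x in `[l, r]) (h x * leakage s x).
Proof.
move=> ch; have cg := @continuous_gaussian_shift R s phi0.
have c1 : continuous (fun x : R => h x * gaussian s (x - phi0)).
  by move=> x; apply: cvgM; [exact: ch|exact: cg].
have c2 : continuous (fun x : R => h x * leakage s x).
  by move=> x; apply: cvgM; [exact: ch|exact: continuous_leakage].
rewrite -RintegralZl//; last exact: continuous_interval_integrable.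
rewrite -RintegralD//; last 2 first.
- apply: continuous_interval_integrable => x; apply: cvgMr; exact: c1.
- exact: continuous_interval_integrable.
by apply: eq_Rintegral => x _; rewrite /target_density; ring.
Qed.

Lemma target_massE : target_mass s =
  a ord0 * \int[lebesgue_measure]_(x in `[l, r]) gaussian s (x - phi0) +
  \int[lebesgue_measure]_(x in `[l, r]) leakage s x.
Proof.
have c1 : continuous (fun _ : R => 1 : R) by move=> x; exact: cvg_cst.
have E (f : R -> R) : \int[lebesgue_measure]_(x in `[l, r]) (1 * f x) =
    \int[lebesgue_measure]_(x in `[l, r]) f x.
  by apply: eq_Rintegral => x _; rewrite mul1r.
by have := target_integralE c1; rewrite /target_mass !E.
Qed.

Lemma target_mass_ge_gaussian :
  a ord0 * \int[lebesgue_measure]_(x in `[l, r]) gaussian s (x - phi0) <= target_mass s.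
Proof.
rewrite target_massE lerDl; apply: Rintegral_interval_ge0 => x /leakage_bounds.
by case/andP.
Qed.

Lemma target_mass_ge : a ord0 * s <= target_mass s.
Proof.
apply: le_trans target_mass_ge_gaussian; rewrite ler_wpM2l//.
exact: gaussian_integral_ge.
Qed.

Lemma retained_fraction_ge : a ord0 / 3 <= retained_fraction a phi s `[l, r].
Proof.
rewrite retained_fractionE ler_pdivlMr ?gauss_mass_gt0//.
apply: le_trans target_mass_ge; rewrite -mulrA ler_wpM2l//.
by have := gauss_mass_le s0; lra.
Qed.

Hypothesis a0_gt0 : 0 < a ord0.

Lemma target_mass_gt0 : 0 < target_mass s.
Proof. by apply: lt_le_trans target_mass_ge; rewrite mulr_gt0. Qed.

Definition target_expectation (h : R -> R) : R :=
  (\int[lebesgue_measure]_(x in `[l, r]) (h x * target_density s x)) / target_mass s.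

Lemma target_second_moment_le :
  target_expectation (fun x => (x - phi0) ^+ 2) <=
  16 * s ^+ 2 + Delta ^+ 3 * gaussian s (Delta / 6) / (a ord0 * s).
Proof.
window_facts; have cq : continuous (fun x : R => (x - phi0) ^+ 2).
  move=> x; apply: (@continuous_comp _ _ _ (fun y => y - phi0) (fun z => z ^+ 2)).
    by apply: cvgB; [exact: cvg_id|exact: cvg_cst].
  exact: exprn_continuous.
have S0 := target_mass_gt0; have as0 : 0 < a ord0 * s by exact: mulr_gt0.
have g0 := gaussian_gt0 s (Delta / 6).
rewrite /target_expectation target_integralE// mulrDl lerD//.
  rewrite ler_pdivrMr//.
  apply: (@le_trans _ _ (a ord0 * (16 * s ^+ 3))).
    by rewrite ler_wpM2l// gaussian_second_moment_le.
  rewrite (_ : a ord0 * (16 * s ^+ 3) = 16 * s ^+ 2 * (a ord0 * s)); last by ring.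
  by rewrite ler_wpM2l ?target_mass_ge// mulr_ge0// sqr_ge0.
rewrite ler_pdivrMr// mulrAC ler_pdivlMr//.
apply: (@le_trans _ _ (Delta ^+ 3 * gaussian s (Delta / 6) * (a ord0 * s))); last first.
  by rewrite ler_wpM2l ?target_mass_ge// mulr_ge0 ?exprn_ge0// ltW.
rewrite ler_wpM2r ?(ltW as0)//.
rewrite (_ : Delta ^+ 3 * gaussian s (Delta / 6) =
  (Delta ^+ 2 * gaussian s (Delta / 6)) * (r - l)); last by rewrite lr; ring.
apply: Rintegral_interval_ub; first by lra.
  by move=> x; apply: cvgM; [exact: cq|exact: continuous_leakage].
move=> x xlr; have /andP[k1 k2] := leakage_bounds xlr.
apply: ler_pM => //; first exact: sqr_ge0.
move: xlr => /andP[x1 x2].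
rewrite -real_normK ?num_real// lerXn2r ?nnegrE ?(ltW Delta0)//.
by rewrite ler_norml; apply/andP; split; lra.
Qed.

(** The signal part has mean exactly [tilted_mean l r s phi0], so the difference is the integral of
    [(x - m) * leakage s x] over the mass; [m] is in the window, hence [|x - m| <= Delta]. *)
Lemma target_mean_close :
  `|target_expectation id - tilted_mean l r s phi0| <=
  Delta ^+ 2 * gaussian s (Delta / 6) / (a ord0 * s).
Proof.
window_facts; have S0 := target_mass_gt0; have as0 : 0 < a ord0 * s by exact: mulr_gt0.
have c1 : continuous (fun _ : R => 1 : R) by move=> x; exact: cvg_cst.
have cid : continuous (id : R -> R) by move=> x; exact: cvg_id.
have cg := @continuous_gaussian_shift R s phi0.
have cxg : continuous (fun x : R => x * gaussian s (x - phi0)).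
  by move=> x; apply: cvgM; [exact: cvg_id|exact: cg].
set m := tilted_mean l r s phi0.
pose G := \int[lebesgue_measure]_(x in `[l, r]) gaussian s (x - phi0).
pose G1 := \int[lebesgue_measure]_(x in `[l, r]) (x * gaussian s (x - phi0)).
have G0 : 0 < G by exact: lt_le_trans s0 (gaussian_integral_ge s0 phi0_l phi0_r).
have mE : m = G1 / G.
  rewrite /m /tilted_mean !tilted_integral_gaussian//.
  have -> : \int[lebesgue_measure]_(x in `[l, r]) (1 * gaussian s (x - phi0)) = G.
    by apply: eq_Rintegral => x _; rewrite mul1r.
  set e := expR _; have e0 : e != 0 by rewrite gt_eqF ?expR_gt0.
  by rewrite -/G -/G1; field; rewrite e0 gt_eqF.
have ml : l <= m.
  rewrite mE ler_pdivlMr// /G -RintegralZl//; last exact: continuous_interval_integrable.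
  apply: Rintegral_interval_le => //; first by move=> x; apply: cvgMr; exact: cg.
  by move=> x /andP[x1 _]; rewrite ler_wpM2r// ltW ?gaussian_gt0.
have mr : m <= r.
  rewrite mE ler_pdivrMr// /G -RintegralZl//; last exact: continuous_interval_integrable.
  apply: Rintegral_interval_le => //; first by move=> x; apply: cvgMr; exact: cg.
  by move=> x /andP[_ x2]; rewrite ler_wpM2r// ltW ?gaussian_gt0.
pose L := \int[lebesgue_measure]_(x in `[l, r]) leakage s x.
pose L1 := \int[lebesgue_measure]_(x in `[l, r]) (x * leakage s x).
have cL := continuous_leakage.
have cxL : continuous (fun x : R => x * leakage s x).
  by move=> x; apply: cvgM; [exact: cvg_id|exact: cL].
have cdL : continuous (fun x : R => (x - m) * leakage s x).
  move=> x; apply: cvgM; last exact: cL.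
  by apply: cvgB; [exact: cvg_id|exact: cvg_cst].
have E : target_expectation id - m =
    (\int[lebesgue_measure]_(x in `[l, r]) ((x - m) * leakage s x)) / target_mass s.
  have -> : \int[lebesgue_measure]_(x in `[l, r]) ((x - m) * leakage s x) = L1 - m * L.
    rewrite /L1 /L -RintegralZl//; last exact: continuous_interval_integrable.
    rewrite -RintegralB//; last 2 first.
    - exact: continuous_interval_integrable.
    - apply: continuous_interval_integrable => x; apply: cvgMr; exact: cL.
    by apply: eq_Rintegral => x _; ring.
  rewrite /target_expectation target_integralE// -/G1 -/L1.
  have SE := target_massE; rewrite -/G -/L in SE.
  have G1E : G1 = m * G by rewrite mE divfK// gt_eqF.
  apply: (mulIf (lt0r_neq0 S0)); rewrite mulrBl !divfK ?gt_eqF//.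
  by rewrite SE G1E; ring.
rewrite E normrM normfV (gtr0_norm S0) ler_pdivrMr// mulrAC ler_pdivlMr//.
apply: (@le_trans _ _ (Delta ^+ 2 * gaussian s (Delta / 6) * (a ord0 * s))); last first.
  rewrite ler_wpM2l ?target_mass_ge// mulr_ge0 ?sqr_ge0//.
  by rewrite ltW ?gaussian_gt0.
rewrite ler_wpM2r ?(ltW as0)//.
apply: le_trans (le_normr_Rintegral _ (continuous_interval_integrable l r cdL)) _ => //.
rewrite (_ : Delta ^+ 2 * gaussian s (Delta / 6) =
  (Delta * gaussian s (Delta / 6)) * (r - l)); last by rewrite lr; ring.
apply: Rintegral_interval_ub; first by lra.
  by move=> x; apply: cvg_norm; exact: cdL.
move=> x xlr; have /andP[k1 k2] := leakage_bounds xlr.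
rewrite normrM (ger0_norm k1); apply: ler_pM => //.
by move: xlr => /andP[x1 x2]; rewrite ler_norml; apply/andP; split; lra.
Qed.

End window_density.

(** * The maximiser of the likelihood *)

Section real_inequalities.
Context (R : realFieldType).
Implicit Types A D s t q E u w i b c : R.

(** [94 * s ^+ 2] is [2 * s ^+ 2] times the bound 47 on [ln 48], the price of comparing the
    normalizations of a phase outside the window and of [phi0]. *)
Lemma outside_gap A t s q E : 0 <= A -> 0 <= t ->
  A ^+ 2 + (8 * A * t + 16 * t ^+ 2) * 2^-1 <= E ->
  100 * s ^+ 2 <= t ^+ 2 -> q <= t ^+ 2 -> 0 < s ->
  (A + t) ^+ 2 + q + 94 * s ^+ 2 < E.
Proof.
move=> A0 t0 h1 h2 h3 s0; have As : 0 <= A * t by rewrite mulr_ge0.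
have s12 : 0 < s ^+ 2 by rewrite exprn_gt0.
by rewrite sqrrD; lra.
Qed.

Lemma sqr_ratio_le s t : 0 <= s -> s <= 48 * t / 480 -> 100 * s ^+ 2 <= t ^+ 2.
Proof.
move=> s0 st; have t0 : 0 <= t by lra.
have : (10 * s) ^+ 2 <= t ^+ 2 by rewrite lerXn2r ?nnegrE ?mulr_ge0//; lra.
by rewrite exprMn; lra.
Qed.

Lemma one_sub_ratio_ge t q : 0 < t -> q <= t ^+ 2 -> 2^-1 <= 1 - q / (4 * t) ^+ 2.
Proof.
move=> t0 qt; rewrite lerBrDl -lerBrDr ler_pdivrMr ?exprn_gt0 ?mulr_gt0//.
by rewrite exprMn; have := sqr_ge0 t; lra.
Qed.

Lemma combine_objectives e u w i b c1 c2 : u + w + 47 < e -> - u + c1 <= i ->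
  b <= c2 -> c2 - c1 <= 47 -> - e - i < - w - b.
Proof. lra. Qed.

End real_inequalities.

Lemma ln48_le (R : realType) : ln 48 <= 47 :> R.
Proof.
rewrite (_ : 48 = 1 + 47 :> R); last by ring.
by apply: le_ln1Dx; lra.
Qed.

Section fmpe_argmax.
Context (R : realType) (l r Delta s phi0 : R) (M : nat) (x : nat -> R).
Hypothesis s0 : 0 < s.
Hypothesis Delta0 : 0 < Delta.
Hypothesis inner_l : l <= phi0 - Delta / 6.
Hypothesis inner_r : phi0 + Delta / 6 <= r.
Hypothesis lr : r - l = Delta.
Hypothesis outer_l : 0 <= phi0 - Delta.
Hypothesis outer_r : phi0 + Delta < 2 * pi.
Hypothesis M0 : (0 < M)%N.
Hypothesis x_itv : forall k, (k < M)%N -> l <= x k <= r.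

Local Ltac window_facts :=
  move: s0 Delta0 inner_l inner_r lr outer_l outer_r => ? ? ? ? ? ? ?.

Definition sample_mean (M : nat) (f : nat -> R) : R := M%:R^-1 * \sum_(k < M) f k.

Lemma sample_meanD f g :
  sample_mean M (fun k => f k + g k) = sample_mean M f + sample_mean M g.
Proof. by rewrite /sample_mean big_split mulrDr. Qed.

Lemma sample_meanZ c f : sample_mean M (fun k => c * f k) = c * sample_mean M f.
Proof. by rewrite /sample_mean -mulr_sumr mulrCA. Qed.

Lemma sample_mean_cst c : sample_mean M (fun=> c) = c.
Proof.
rewrite /sample_mean sumr_const card_ord -(mulr_natl c) mulrA mulVf ?mul1r//.
by rewrite pnatr_eq0 -lt0n.
Qed.

Lemma sample_mean_le f g : (forall k, (k < M)%N -> f k <= g k) ->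
  sample_mean M f <= sample_mean M g.
Proof.
by move=> fg; rewrite ler_wpM2l// ler_sum// => k _; exact: fg.
Qed.

Definition arc_mass (phi : R) : R :=
  \int[lebesgue_measure]_(y in `[l, r]) gaussian s (arc_distance phi y).

Let cga phi : continuous (fun y : R => gaussian s (arc_distance phi y)).
Proof.
move=> y; apply: (@continuous_comp _ _ _ (arc_distance phi) (gaussian s)).
  exact: continuous_arc_distance.
exact: continuous_gaussian.
Qed.

Lemma arc_mass_gt0 phi : 0 < arc_mass phi.
Proof.
window_facts.
pose B := 2 * pi + `|l| + `|r| + `|phi|.
have p0 := pi_gt0 R.
have B0 : 0 <= B by rewrite !addr_ge0// mulr_ge0// ltW.
apply: (@lt_le_trans _ _ (gaussian s B * (r - l))).
  by rewrite mulr_gt0 ?gaussian_gt0//; lra.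
apply: Rintegral_interval_lb => //; first by lra.
  by move=> y _; rewrite ltW ?gaussian_gt0.
move=> y /andP[y1 y2]; rewrite -(gaussian_norm s (arc_distance phi y)).
apply: gaussian_nonincreasing => //.
have yB : `|y| <= `|l| + `|r|.
  rewrite ler_norml; have := ler_norm (- l); have := ler_norm r.
  rewrite normrN; have := normr_ge0 l; have := normr_ge0 r => ? ? ? ?.
  by apply/andP; split; lra.
have yp : `|y - phi| <= `|l| + `|r| + `|phi|.
  by rewrite (le_trans (ler_normB _ _))// lerD2r.
have yp0 : 0 <= `|y - phi| by [].
rewrite /arc_distance /B; move: (`|y - phi|) yp yp0 => u ? ?.
have [h|h] := leP u (2 * pi - u); rewrite ler_norml; apply/andP; split; lra.
Qed.

Lemma objectiveE phi : 0 <= phi < 2 * pi ->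
  fmpe_objective s `[l, r] M x phi =
  - sample_mean M (fun k => arc_distance phi (x k) ^+ 2) / (2 * s ^+ 2)
  - ln (arc_mass phi).
Proof.
window_facts; move=> /andP[p1 p2].
have near y : l <= y <= r -> `|y - phi| <= 2 * pi.
  by move=> /andP[? ?]; rewrite ler_norml; apply/andP; split; lra.
have N0 := gauss_mass_gt0 s0.
have A0 := arc_mass_gt0 phi.
have -> : fmpe_objective s `[l, r] M x phi = sample_mean M (fun k =>
    (- (2 * s ^+ 2)^-1) * arc_distance phi (x k) ^+ 2 + - ln (arc_mass phi)).
  congr (_ * _); apply: eq_bigr => k _; have xk := x_itv (ltn_ord k).
  rewrite /fmpe_model gauss_kernelE ?near//.
  have -> : \int[lebesgue_measure]_(y in `[l, r]) gauss_kernel s (y - phi) =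
      arc_mass phi / gauss_mass s.
    have mI : measurable (`[l, r]%classic : set (measurableTypeR R)) by [].
    rewrite -(RintegralZr _ mI (continuous_interval_integrable l r (@cga phi))).
    apply: eq_Rintegral => y; rewrite inE/= in_itv/= => ylr.
    by rewrite gauss_kernelE ?near.
  rewrite invfM invrK mulrACA mulVf ?mulr1 ?gt_eqF//.
  rewrite ln_div ?posrE ?gaussian_gt0// /gaussian expRK.
  by rewrite mulNr mulNr mulrC.
by rewrite sample_meanD sample_meanZ sample_mean_cst mulNr mulrC mulNr.
Qed.

(** The last term does not depend on [phi]; the rest is the function of the sample mean treated by
    [tilted_likelihood_max]. *)
Lemma objective_in_window phi : l <= phi <= r ->
  fmpe_objective s `[l, r] M x phi =
  sample_mean M x * phi / s ^+ 2 - ln (tilted_integral l r s (fun=> 1) phi)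
  - sample_mean M (fun k => x k ^+ 2) / (2 * s ^+ 2).
Proof.
window_facts; move=> /andP[p1 p2].
have arcE y : l <= y <= r -> arc_distance phi y = `|y - phi|.
  move=> /andP[y1 y2]; rewrite /arc_distance min_l//.
  have : `|y - phi| <= Delta by rewrite ler_norml; apply/andP; split; lra.
  by lra.
rewrite objectiveE; last by apply/andP; split; lra.
have -> : sample_mean M (fun k => arc_distance phi (x k) ^+ 2) =
    sample_mean M (fun k => x k ^+ 2 + ((- (2 * phi)) * x k + phi ^+ 2)).
  congr (_ * _); apply: eq_bigr => k _; have xk := x_itv (ltn_ord k).
  by rewrite arcE// real_normK ?num_real//; ring.
rewrite !sample_meanD sample_meanZ sample_mean_cst.
have c1 : continuous (fun _ : R => 1 : R) by move=> y; exact: cvg_cst.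
have -> : tilted_integral l r s (fun=> 1) phi =
    expR (phi ^+ 2 / (2 * s ^+ 2)) * arc_mass phi.
  rewrite tilted_integral_gaussian//; congr (_ * _); apply: eq_Rintegral => y.
  by rewrite inE/= in_itv/= => ylr; rewrite arcE// gaussian_norm mul1r.
rewrite lnM ?posrE ?expR_gt0 ?arc_mass_gt0// expRK.
by field; rewrite gt_eqF.
Qed.

Hypothesis s_small : s <= Delta / 480.
Hypothesis x_concentrated :
  sample_mean M (fun k => (x k - phi0) ^+ 2) <= (Delta / 48) ^+ 2.

Lemma arc_mass_phi0_le : arc_mass phi0 <= Delta.
Proof.
window_facts; rewrite -[leRHS]mul1r -[X in 1 * X]lr; apply: Rintegral_interval_ub => //.
  by lra.
by move=> y _; exact: gaussian_le1.
Qed.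

(* A phase outside the window gives its highest likelihood to the samples near
   one end of the window, at distance [A] from the phase, but most samples are
   [Delta / 12] further inside; the mass near that end bounds the normalization
   from below. *)
Lemma objective_outside phi : 0 <= phi < 2 * pi -> ~~ (l <= phi <= r) ->
  fmpe_objective s `[l, r] M x phi < fmpe_objective s `[l, r] M x phi0.
Proof.
window_facts; move: s_small x_concentrated => ss xc phi2 plr.
pose s1 := Delta / 48; pose q := sample_mean M (fun k => (x k - phi0) ^+ 2).
have s1_gt0 : 0 < s1 by rewrite divr_gt0.
have DE : Delta = 48 * s1 by rewrite /s1; field.
have qs : q <= s1 ^+ 2 by exact: xc.
clearbody s1; have s1_ge0 := ltW s1_gt0.
have [|||||A1 [A2 [A1_ge0 A2_ge0 tent]]] := @arc_distance_tent R l r phi 0.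
- by [].
- exact: phi2.
- rewrite subr0 addr0; move: plr; rewrite negb_and -!ltNge.
  by move=> /orP[/ltW ->//|/ltW ->]; rewrite orbT.
- by lra.
- by lra.
pose A := Num.min A1 A2.
have A_ge0 : 0 <= A by rewrite le_min A1_ge0.
have AA1 : A <= A1 by rewrite ge_min lexx.
have AA2 : A <= A2 by rewrite ge_min lexx orbT.
have s20 : 0 < s ^+ 2 by rewrite exprn_gt0.
(* Points within [4 * s1 = Delta / 12] of [phi0] are at least [4 * s1] from both ends, so their
   squared distance is at least [(A + 4 * s1) ^+ 2]; elsewhere it is at least [A ^+ 2]. Replacing
   the indicator by a parabola below it, as in Chebyshev's inequality, lets the average depend on
   the samples through [q] only. *)
have arc_lb y : l <= y <= r ->
    A ^+ 2 + (8 * A * s1 + 16 * s1 ^+ 2) * (1 - (y - phi0) ^+ 2 / (4 * s1) ^+ 2) <=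
    arc_distance phi y ^+ 2.
  move=> ylr; have [_ ->] := tent _ ylr; move: ylr => /andP[y1 y2].
  have c0 : 0 <= 8 * A * s1 + 16 * s1 ^+ 2.
    by rewrite addr_ge0 ?mulr_ge0 ?exprn_ge0// ltW.
  have d0 : 0 < (4 * s1) ^+ 2 by rewrite exprn_gt0// mulr_gt0.
  have [h|h] := leP `|y - phi0| (4 * s1).
    apply: (@le_trans _ _ ((A + 4 * s1) ^+ 2)).
      have -> : (A + 4 * s1) ^+ 2 = A ^+ 2 + (8 * A * s1 + 16 * s1 ^+ 2) * 1 by ring.
      by rewrite lerD2l ler_wpM2l// lerBlDr lerDl divr_ge0 ?sqr_ge0.
    move: h; rewrite ler_norml => /andP[h1 h2].
    rewrite lerXn2r ?nnegrE ?addr_ge0 ?mulr_ge0 ?(ltW s1_gt0)//.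
      by rewrite le_min; apply/andP; split; lra.
    by rewrite le_min; apply/andP; split; lra.
  apply: (@le_trans _ _ (A ^+ 2)).
    rewrite -lerBrDl subrr mulr_ge0_le0// subr_le0 ler_pdivlMr// mul1r.
    rewrite -[leRHS]real_normK ?num_real// lerXn2r ?nnegrE ?mulr_ge0 ?(ltW s1_gt0)//.
    exact: ltW.
  rewrite lerXn2r ?nnegrE// le_min; first by apply/andP; split; lra.
  by apply/andP; split; lra.
have mass_lb : gaussian s (A + s1) * s1 <= arc_mass phi.
  have key a : l <= a -> a + s1 <= r -> (forall y, a <= y <= a + s1 ->
      0 <= arc_distance phi y <= A + s1) -> gaussian s (A + s1) * s1 <= arc_mass phi.
    move=> la ar ha; rewrite [X in _ * X <= _](_ : s1 = a + s1 - a); last by ring.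
    apply: Rintegral_interval_lb => //; first by lra.
      by move=> y _; rewrite ltW ?gaussian_gt0.
    by move=> y /ha/andP[? ?]; exact: gaussian_nonincreasing.
  have [A12|A12] := leP A1 A2.
    apply: (key l) => [//||y /andP[y1 y2]]; first by lra.
    have [|_ ->] := tent y; first by apply/andP; split; lra.
    rewrite le_min ge_min /A min_l//; apply/andP; split; first by apply/andP; split; lra.
    by apply/orP; left; lra.
  apply: (key (r - s1)) => [||y /andP[y1 y2]]; [lra|lra|].
  have [|_ ->] := tent y; first by apply/andP; split; lra.
  rewrite le_min ge_min /A min_r ?(ltW A12)//; apply/andP; split; first by apply/andP; split; lra.
  by apply/orP; right; lra.
have mean_lb : A ^+ 2 + (8 * A * s1 + 16 * s1 ^+ 2) * (1 - q / (4 * s1) ^+ 2) <=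
    sample_mean M (fun k => arc_distance phi (x k) ^+ 2).
  set c := 8 * A * s1 + 16 * s1 ^+ 2.
  have <- : sample_mean M (fun k => (A ^+ 2 + c) +
      (- (c / (4 * s1) ^+ 2)) * (x k - phi0) ^+ 2) =
      A ^+ 2 + c * (1 - q / (4 * s1) ^+ 2).
    rewrite sample_meanD sample_mean_cst sample_meanZ -/q; ring.
  apply: sample_mean_le => k kM; apply: le_trans (arc_lb _ (x_itv kM)).
  by rewrite -/c le_eqVlt; apply/orP; left; apply/eqP; ring.
have lnI : ln (gaussian s (A + s1) * s1) <= ln (arc_mass phi).
  by rewrite ler_ln ?posrE ?mulr_gt0 ?gaussian_gt0 ?arc_mass_gt0.
rewrite lnM ?posrE ?gaussian_gt0// /gaussian expRK in lnI.
have phi0_2 : 0 <= phi0 < 2 * pi by apply/andP; split; lra.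
rewrite (objectiveE phi2) (objectiveE phi0_2).
have -> : sample_mean M (fun k => arc_distance phi0 (x k) ^+ 2) = q.
  congr (_ * _); apply: eq_bigr => k _.
  have /andP[k1 k2] := x_itv (ltn_ord k).
  rewrite /arc_distance min_l ?real_normK ?num_real//.
  have : `|x k - phi0| <= Delta by rewrite ler_norml; apply/andP; split; lra.
  by lra.
have lnD : ln (arc_mass phi0) <= ln Delta.
  by rewrite ler_ln ?posrE ?arc_mass_gt0// arc_mass_phi0_le.
have ln48 : ln Delta - ln s1 <= 47.
  rewrite -ln_div ?posrE// DE mulfK ?gt_eqF//.
  exact: ln48_le.
set E := sample_mean M (fun k => arc_distance phi (x k) ^+ 2) in mean_lb *.
have q0 : 0 <= q by rewrite mulr_ge0// sumr_ge0// => k _; exact: sqr_ge0.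
have qq := one_sub_ratio_ge s1_gt0 qs.
have h1 : A ^+ 2 + (8 * A * s1 + 16 * s1 ^+ 2) * 2^-1 <= E.
  apply: le_trans mean_lb; rewrite lerD2l ler_wpM2l//.
  by rewrite addr_ge0 ?mulr_ge0 ?exprn_ge0// ltW.
have sss : 100 * s ^+ 2 <= s1 ^+ 2 by apply: sqr_ratio_le; rewrite ?(ltW s0)// -DE.
have h2 : (A + s1) ^+ 2 + q + 94 * s ^+ 2 < E.
  exact: (outside_gap A_ge0 s1_ge0 h1 sss qs).
have h3 : ((A + s1) ^+ 2 + q + 94 * s ^+ 2) / (2 * s ^+ 2) < E / (2 * s ^+ 2).
  by rewrite ltr_pM2r// invr_gt0 mulr_gt0.
have h4 : ((A + s1) ^+ 2 + q + 94 * s ^+ 2) / (2 * s ^+ 2) =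
    (A + s1) ^+ 2 / (2 * s ^+ 2) + q / (2 * s ^+ 2) + 47.
  by field; rewrite gt_eqF.
rewrite h4 in h3; rewrite mulNr in lnI; rewrite !mulNr.
exact: combine_objectives h3 lnI lnD ln48.
Qed.

Lemma fmpe_unique phit thh : is_fmpe s `[l, r] M x phit ->
  l <= thh <= r -> tilted_mean l r s thh = sample_mean M x -> phit = thh.
Proof.
window_facts; move=> [p2 pmax] thlr mE.
have plr : l <= phit <= r.
  apply/negPn/negP => plr; have := objective_outside p2 plr.
  rewrite ltNge => /negP; apply; apply: pmax.
  by apply/andP; split; lra.
apply/eqP/negPn/negP => pth.
have lr' : l < r by lra.
have := tilted_likelihood_max lr' s0 mE pth.
rewrite ltNge => /negP; apply.
have /pmax : 0 <= thh < 2 * pi by move: thlr => /andP[? ?]; apply/andP; split; lra.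
by rewrite (objective_in_window thlr) (objective_in_window plr) lerD2r.
Qed.

End fmpe_argmax.

(** * Error of the estimator *)

Section overlaps.
Local Open Scope complex_scope.
Local Open Scope sesquilinear_scope.
Context (R : realType).

Lemma normc_sqr (z : R[i]) : (ComplexField.Normc.normc z ^+ 2)%:C = z^* * z.
Proof.
case: z => x y; rewrite /= sqr_sqrtr ?addr_ge0 ?sqr_ge0//.
by rewrite /Num.conj/=; simpc; congr (_ +i* _); ring.
Qed.

(** Parseval: the square matrix with orthonormal columns [v j] is also a right inverse of its
    adjoint. *)
Lemma sum_overlap (n : nat) (v : 'I_n -> 'cV[R[i]]_n) (psi : 'cV[R[i]]_n) :
  (forall j k, braket (v j) (v k) = (j == k)%:R) -> braket psi psi = 1 ->
  \sum_j overlap v psi j = 1.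
Proof.
move=> vv pp; pose V : 'M[R[i]]_n := \matrix_(i, j) v j i 0.
have VV : V ^t* *m V = 1%:M.
  apply/matrixP => j k; rewrite [RHS]mxE -vv /braket !mxE.
  by apply: eq_bigr => i _; rewrite !mxE.
have VV' : V *m V ^t* = 1%:M by exact: mulmx1C VV.
have Vp j : (V ^t* *m psi) j 0 = braket (v j) psi.
  by rewrite /braket !mxE; apply: eq_bigr => i _; rewrite !mxE.
have VK : (V ^t*) ^t* = V by apply/matrixP => i j; rewrite !mxE conjCK.
have VpE : (V ^t* *m psi) ^t* = psi ^t* *m V by rewrite trmx_mul map_mxM VK.
have h : psi ^t* *m (V *m V ^t*) *m psi = (V ^t* *m psi) ^t* *m (V ^t* *m psi).
  by rewrite VpE !mulmxA.
have : (\sum_j overlap v psi j)%:C = 1.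
  rewrite -pp /braket -[psi ^t*]mulmx1 -VV' h mxE rmorph_sum/=.
  by apply: eq_bigr => j _; rewrite normc_sqr -Vp !mxE.
by move=> [].
Qed.

Lemma overlap_ge0 (n : nat) (v : 'I_n -> 'cV[R[i]]_n) (psi : 'cV[R[i]]_n) j :
  0 <= overlap v psi j.
Proof. exact: sqr_ge0. Qed.

End overlaps.

Lemma itv_of_close (R : realFieldType) (l r p D x : R) :
  l <= p - D / 6 -> p + D / 6 <= r -> 0 < D -> `|x - p| <= D / 12 -> l <= x <= r.
Proof. by move=> ? ? ?; rewrite ler_norml => /andP[? ?]; apply/andP; split; lra. Qed.

(** * Asymptotic bias and variance of the estimate *)

Section fmpe_asymptotics.
Context (R : realType) (n : nat) (a phi : 'I_n.+1 -> R) (l r Delta s : R).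
Hypothesis s0 : 0 < s.
Hypothesis a_ge0 : forall j, 0 <= a j.
Hypothesis a_sum : \sum_j a j <= 1.
Hypothesis phi_itv : forall j, 0 <= phi j < 2 * pi.
Hypothesis Delta0 : 0 < Delta.
Hypothesis gap : forall j, j != ord0 ->
  phi j < phi ord0 - Delta \/ phi ord0 + Delta < phi j.
Hypothesis inner_l : l <= phi ord0 - Delta / 6.
Hypothesis inner_r : phi ord0 + Delta / 6 <= r.
Hypothesis lr : r - l = Delta.
Hypothesis outer_l : 0 <= phi ord0 - Delta.
Hypothesis outer_r : phi ord0 + Delta < 2 * pi.
Hypothesis s_small : s <= Delta / 480.
Hypothesis a0_gt0 : 0 < a ord0.
Notation phi0 := (phi ord0).

Context d (T : measurableType d) (Pr : probability T R) (X est : nat -> {RV Pr >-> R}).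
Hypothesis indX : mutually_independent X.
Hypothesis densX : forall k,
  has_density_on (X k) `[l, r] (filtered_density a phi s `[l, r]).
Hypothesis estP : forall M w, is_fmpe s `[l, r] M (fun k => X k w) (est M w).

Local Ltac window_facts :=
  move: s0 inner_l inner_r lr outer_l outer_r Delta0 s_small =>
  ? ? ? ? ? ? ? ?.

Let s_small6 : s <= Delta / 6.
Proof. by window_facts; lra. Qed.

Let mass_gt0 : 0 < target_mass a phi l r s.
Proof. exact: (target_mass_gt0 s0 a_ge0 a_sum phi_itv Delta0 gap). Qed.

Local Notation Etarget := (target_expectation a phi l r s).

(** Samples are in the window only almost surely. Clipping makes functions of them bounded
    everywhere, keeps them continuous and leaves expectations unchanged. *)
Definition clip (l r x : R) : R := Num.max l (Num.min r x).

Let lr' : l <= r. Proof. by window_facts; lra. Qed.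

Lemma clip_itv x : l <= clip l r x <= r.
Proof. by rewrite le_max lexx/= ge_max lr' ge_min lexx. Qed.

Lemma clip_id x : l <= x <= r -> clip l r x = x.
Proof. by move=> /andP[x1 x2]; rewrite /clip min_r// max_r. Qed.

Lemma continuous_clip : continuous (clip l r).
Proof.
move=> x; apply: (@continuous_max _ _ (fun=> l) (fun x => Num.min r x)).
  exact: cvg_cst.
apply: (@continuous_min _ _ (fun=> r) (fun x => x)); [exact: cvg_cst|exact: cvg_id].
Qed.

Let cclip2 b : continuous (fun x : R => (clip l r x - b) ^+ 2).
Proof.
move=> x; apply: (@continuous_comp _ _ _ (fun y => clip l r y - b) (fun z => z ^+ 2)).
  by apply: cvgB; [exact: continuous_clip|exact: cvg_cst].
exact: exprn_continuous.
Qed.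

Let mclip : bounded_measurable (clip l r : R -> R).
Proof.
split; first exact: continuous_measurable_fun continuous_clip.
exists (`|l| + `|r|) => x; have /andP[h1 h2] := clip_itv x.
rewrite ler_norml; have := ler_norm (- l); have := ler_norm r.
rewrite normrN; have := normr_ge0 l; have := normr_ge0 r => ? ? ? ?.
by apply/andP; split; lra.
Qed.

Let mclipB b : bounded_measurable (fun x : R => clip l r x - b).
Proof. by apply: bounded_measurableD => //; exact: bounded_measurable_cst. Qed.

Lemma Rexp_target (h : R -> R) k : continuous h -> bounded_measurable h ->
  (forall x, 0 <= h x) -> \int[Pr]_w h (X k w) = Etarget h.
Proof.
move=> ch mh h0; have cd := @continuous_target_density R n a phi s.
rewrite (Rexp_density (densX k)
  (p := fun x => target_density a phi s x / target_mass a phi l r s))//.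
- rewrite /target_expectation -RintegralZr//; last first.
    apply: continuous_interval_integrable => x.
    by apply: cvgM; [exact: ch|exact: cd].
  by apply: eq_Rintegral => x _; rewrite mulrA.
- by move=> x; apply: cvgMl; exact: cd.
- move=> x xlr; exact: (filtered_densityE a s0 phi_itv Delta0).
- move=> x xlr; apply: divr_ge0; last exact: ltW.
  exact: (target_density_ge0 s0 a_ge0 a_sum phi_itv Delta0 gap inner_l inner_r
    lr outer_l outer_r xlr).
Qed.

Lemma target_expectation_clip (h : R -> R) :
  Etarget (fun x => h (clip l r x)) = Etarget h.
Proof.
congr (_ / _); apply: eq_Rintegral => x; rewrite inE/= in_itv/= => xlr.
by rewrite clip_id.
Qed.

Let m := Etarget id.
Let q := Etarget (fun x => (x - phi0) ^+ 2).
Let v := Etarget (fun x => (x - m) ^+ 2).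

Let Eclip k : \int[Pr]_w clip l r (X k w) = m.
Proof.
rewrite (@Rexp_target (clip l r)) ?(target_expectation_clip id)//.
  exact: continuous_clip.
move=> x; have /andP[+ _] := clip_itv x; apply: le_trans.
by window_facts; lra.
Qed.

Let Eclip2 b k : \int[Pr]_w (clip l r (X k w) - b) ^+ 2 = Etarget (fun x => (x - b) ^+ 2).
Proof.
rewrite (@Rexp_target (fun x => (clip l r x - b) ^+ 2)).
- exact: (target_expectation_clip (fun x => (x - b) ^+ 2)).
- exact: cclip2.
- exact: (bounded_measurableX 2 (mclipB b)).
- by move=> x; exact: sqr_ge0.
Qed.

Let mclipX k : bounded_measurable (fun w => clip l r (X k w)).
Proof. exact: bounded_measurable_comp. Qed.

(** Expanding the same variance around [m] and around [phi0] shows that [q - v] is the square of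
    [m - phi0]. *)
Lemma target_variance_le : v <= q.
Proof.
have E b := variance_bounded_measurable Pr b (mclipX 0).
have := E m; rewrite (E phi0) !Eclip2 => -[].
rewrite !RexpB ?Eclip ?Rexp_cst//; try exact: bounded_measurable_cst.
by rewrite subrr expr0n subr0 -/v -/q => <-; rewrite lerBlDr lerDl sqr_ge0.
Qed.

Let outside_mean k : \int[Pr]_w (\1_(~` `[l, r]) (X k w) : R) = 0.
Proof.
have mA : measurable (~` `[l, r]%classic : set R) by exact: measurableC.
have := densX k mA; rewrite setIC setICr integral_set0 => h.
have mXA : measurable (X k @^-1` (~` `[l, r])).
  by rewrite -[_ @^-1` _]setTI; apply: (measurable_funP (X k)).
have -> : \int[Pr]_w (\1_(~` `[l, r]) (X k w) : R) = fine (Pr (X k @^-1` (~` `[l, r]))).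
  by rewrite -Rexp_indic.
by move: h; rewrite /distribution /pushforward => ->.
Qed.

Let h1 x : R := clip l r x - m.
Let h2 x : R := (clip l r x - phi0) ^+ 2 - q.

Let mh1 : bounded_measurable h1. Proof. exact: mclipB. Qed.
Let mh2 : bounded_measurable h2.
Proof.
apply: bounded_measurableD; last exact: bounded_measurable_cst.
exact: bounded_measurableX.
Qed.

(* [O] vanishes almost surely: it covers the null event of samples outside the
   window, where the likelihood is not controlled. *)
Let S M w := sample_mean M (fun k => h1 (X k w)).
Let S2 M w := sample_mean M (fun k => h2 (X k w)).
Let O M w : R := \sum_(k < M) \1_(~` `[l, r]) (X k w).
Let W M w := S M w ^+ 4 + S2 M w ^+ 4 + O M w.

Let bm_mean M (h : R -> R) : bounded_measurable h ->
  bounded_measurable (fun w => sample_mean M (fun k => h (X k w))).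
Proof.
move=> mh; apply: bounded_measurableM; first exact: bounded_measurable_cst.
by apply: bounded_measurable_sum => k; exact: bounded_measurable_comp.
Qed.

Let O_bm M : bounded_measurable (O M).
Proof.
apply: bounded_measurable_sum => k; apply: bounded_measurable_comp => //.
by apply: bounded_measurable_indic; exact: measurableC.
Qed.

Let S_mean M : (0 < M)%N -> \int[Pr]_w S M w = 0.
Proof.
move=> M0; rewrite /S /sample_mean RexpZ; last first.
  by apply: bounded_measurable_sum => k; exact: bounded_measurable_comp.
rewrite Rexp_centered_sum ?mulr0// => k.
by rewrite RexpB ?Eclip ?Rexp_cst ?subrr//; exact: bounded_measurable_cst.
Qed.

Let h1_mean k : \int[Pr]_w h1 (X k w) = 0.
Proof. by rewrite RexpB ?Eclip ?Rexp_cst ?subrr//; exact: bounded_measurable_cst. Qed.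

Let h2_mean k : \int[Pr]_w h2 (X k w) = 0.
Proof.
rewrite RexpB ?Eclip2 ?Rexp_cst ?subrr//; last exact: bounded_measurable_cst.
exact: (bounded_measurable_comp (Y := X k)
  (f := fun x => (clip l r x - phi0) ^+ 2) _ (bounded_measurableX 2 (mclipB phi0))).
Qed.

Let S_sqr M : (0 < M)%N -> \int[Pr]_w (S M w) ^+ 2 = v / M%:R.
Proof.
move=> M0; rewrite /S /sample_mean; under eq_Rintegral do rewrite exprMn.
rewrite RexpZ; last first.
  apply: bounded_measurableX.
  by apply: bounded_measurable_sum => k; exact: bounded_measurable_comp.
rewrite (@Rexp_centered_sum_sqr _ _ _ _ _ indX h1 v)//; last by move=> k; exact: Eclip2.
by rewrite -mulr_natr; field; rewrite pnatr_eq0 -lt0n.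
Qed.

Let pow4_mean (h : R -> R) : bounded_measurable h -> (forall k, \int[Pr]_w h (X k w) = 0) ->
  exists2 C : R, 0 <= C & forall M, (0 < M)%N ->
  \int[Pr]_w (sample_mean M (fun k => h (X k w))) ^+ 4 <= C / M%:R ^+ 2.
Proof.
move=> mh h_mean; have [C C0 hC] := Rexp_centered_sum_pow4 indX mh h_mean.
exists C => // M M0; have MR : (0 : R) < M%:R by rewrite ltr0n.
rewrite /sample_mean; under eq_Rintegral do rewrite exprMn.
rewrite RexpZ; last first.
  apply: bounded_measurableX.
  by apply: bounded_measurable_sum => k; exact: bounded_measurable_comp.
apply: (@le_trans _ _ (M%:R^-1 ^+ 4 * (C * M%:R ^+ 2))).
  by rewrite ler_wpM2l ?exprn_ge0// hC.
by rewrite le_eqVlt; apply/orP; left; apply/eqP; field; rewrite gt_eqF.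
Qed.

Let W_mean : exists C : R, forall M, (0 < M)%N -> \int[Pr]_w W M w <= C / M%:R ^+ 2.
Proof.
have [C1 _ hC1] := pow4_mean mh1 h1_mean; have [C2 _ hC2] := pow4_mean mh2 h2_mean.
exists (C1 + C2) => M M0; rewrite /W.
have b1 := bounded_measurableX 4 (bm_mean M mh1).
have b2 := bounded_measurableX 4 (bm_mean M mh2).
rewrite RexpD//; last exact: bounded_measurableD.
rewrite RexpD// /O Rexp_sum; last first.
  move=> k; apply: bounded_measurable_comp => //.
  by apply: bounded_measurable_indic; exact: measurableC.
rewrite (big1 _ _ _ (fun (k : 'I_M) _ => outside_mean k)) addr0 mulrDl.
exact: lerD (hC1 M M0) (hC2 M M0).
Qed.

Let S_bound M w : `|S M w| <= Delta.
Proof.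
case: M => [|M]; first by rewrite /S /sample_mean big_ord0 mulr0 normr0 ltW.
rewrite /S /sample_mean normrM normfV normr_nat ler_pdivrMl// mulrC mulr_natr.
rewrite -[X in _ *+ X]card_ord -sumr_const; apply: le_trans (ler_norm_sum _ _ _) _.
apply: ler_sum => k _.
have bl : bounded_measurable (fun _ : T => l) by exact: bounded_measurable_cst.
have br : bounded_measurable (fun _ : T => r) by exact: bounded_measurable_cst.
have w0 : l <= m.
  have := @Rexp_le _ _ _ Pr _ _ bl (mclipX 0).
  by rewrite Rexp_cst Eclip; apply=> x; have /andP[] := clip_itv (X 0 x).
have w1 : m <= r.
  have := @Rexp_le _ _ _ Pr _ _ (mclipX 0) br.
  by rewrite Rexp_cst Eclip; apply=> x; have /andP[] := clip_itv (X 0 x).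
have /andP[c0 c1] := clip_itv (X k w); window_facts.
by rewrite /h1 ler_norml; apply/andP; split; lra.
Qed.

Hypothesis leak2 : Delta ^+ 3 * gaussian s (Delta / 6) / (a ord0 * s) <= s ^+ 2.
Hypothesis leak1 : 48 * (Delta ^+ 2 * gaussian s (Delta / 6) / (a ord0 * s)) <=
  Delta / 24.

Let q_le : q <= 17 * s ^+ 2.
Proof.
have := target_second_moment_le s0 a_ge0 a_sum phi_itv Delta0 gap inner_l inner_r
  lr outer_l outer_r s_small6 a0_gt0; rewrite -/q.
by move: leak2 => ? ?; lra.
Qed.

Let slope x : `|x - phi0| <= Delta / 12 -> 48^-1 <= tilted_var l r s x / s ^+ 2.
Proof.
window_facts; rewrite ler_norml => /andP[x1 x2].
rewrite ler_pdivlMr ?exprn_gt0// mulrC.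
by apply: tilted_var_ge => //; lra.
Qed.

(** 48 is the inverse of the slope bound and 17 comes from [q_le]. [leak1] puts [p] within
    [Delta / 24] of [phi0], half of the radius where the slope bound holds. *)
Lemma fmpe_asymptotics : exists p V : R,
  [/\ `|p - phi0| <= 48 * (Delta ^+ 2 * gaussian s (Delta / 6) / (a ord0 * s)),
      V <= 48 ^+ 2 * (17 * s ^+ 2), asymptotic_bias est phi0 (p - phi0) &
      asymptotic_variance est V].
Proof.
window_facts; move: q_le => qle.
have lr2 : l < r by lra.
have dmean := is_derive_tilted_mean lr2 s0.
have mclose := target_mean_close s0 a_ge0 a_sum phi_itv Delta0 gap inner_l inner_r
  lr outer_l outer_r s_small6 a0_gt0.
move: leak1 => lk1; rewrite -/m in mclose.
set lk := _ / (a ord0 * s) in mclose lk1 *.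
have k0 : (0 : R) < 48^-1 by rewrite invr_gt0.
have [|p pE pclose] := @derive_lb_inverse _ _ _ dmean phi0 (Delta / 12) 48^-1 m k0 slope.
  by apply: (le_trans mclose); lra.
rewrite invrK in pclose.
have pphi : `|p - phi0| <= 48 * lk by apply: (le_trans pclose); rewrite ler_wpM2l.
have p24 : `|p - phi0| <= Delta / 12 / 2 by apply: (le_trans pphi); lra.
set D := tilted_var l r s p / s ^+ 2.
have D48 : 48^-1 <= D by apply: slope; lra.
have Dgt0 : 0 < D by apply: lt_le_trans D48.
have Dinv : D^-1 <= 48 by rewrite -[leRHS]invrK lef_pV2 ?posrE.
have tau0 : 0 < Delta / 12 by rewrite divr_gt0.
pose B := 2 * pi + Delta.
have p0 := pi_gt0 R.
have est_bound M w : `|est M w| <= B.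
  have [/andP[e1 e2] _] := estP M w.
  by rewrite /B ger0_norm//; lra.
have SB M w : `|S M w| <= B by apply: (le_trans (S_bound M w)); rewrite /B; lra.
have S_bm M : bounded_measurable (S M) by exact: bm_mean.
have W_bm M : bounded_measurable (W M).
  apply: bounded_measurableD => //; apply: bounded_measurableD.
    exact: (bounded_measurableX 4 (bm_mean M mh1)).
  exact: (bounded_measurableX 4 (bm_mean M mh2)).
have O_ge0 M w : 0 <= O M w by apply: sumr_ge0 => k _; rewrite indicE.
have pow4 (u : R) : 0 <= u ^+ 4 by rewrite (exprM u 2 2) sqr_ge0.
have W_ge0 M w : 0 <= W M w by rewrite !addr_ge0.
have [C hC] := W_mean.
pose B' := B + `|p| + D^-1 * B.
have res_bound M w : `|est M w - p - D^-1 * S M w| <= B'.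
  rewrite /B' (le_trans (ler_normB _ _))// lerD//.
    by rewrite (le_trans (ler_normB _ _))// lerD.
  by rewrite normrM gtr0_norm ?invr_gt0// ler_wpM2l// invr_ge0 ltW.
have B'0 : 0 <= B' by apply: le_trans (res_bound 0 point).
have linearized e : 0 < e -> exists2 L, 0 <= L & forall M w, (0 < M)%N ->
    `|est M w - p - D^-1 * S M w| <= e * `|S M w| + L * W M w.
  move=> e0.
  have [dl dl0 hdl] := derive_inverse_linearized dmean k0 tau0 slope p24 e0.
  rewrite pE -/D in hdl.
  (* Slack in the concentration required to exclude maximisers outside the window:
     [(Delta / 48) ^+ 2] is at least [100 * s ^+ 2], and [q] at most [17 * s ^+ 2]. *)
  pose rho := (Delta / 48) ^+ 2 - q.
  have rho0 : 0 < rho.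
    have ssq : s ^+ 2 <= (Delta / 480) ^+ 2.
      by rewrite !expr2; apply: ler_pM; rewrite // ltW.
    have D2 : 0 < Delta ^+ 2 by rewrite exprn_gt0.
    by move: ssq; rewrite /rho !exprMn; lra.
  have dl4 : 0 < dl ^+ 4 by rewrite exprn_gt0.
  have rho4 : 0 < rho ^+ 4 by rewrite exprn_gt0.
  exists (B' * (1 + dl ^- 4 + rho ^- 4)) => [|M w M0].
    by rewrite mulr_ge0// !addr_ge0// invr_ge0 ltW.
  have eS : 0 <= e * `|S M w| by rewrite mulr_ge0// ltW.
  (* On an exceptional event the residual is at most [B'], while one part of [W] is bounded below:
     [S ^+ 4] by [dl ^+ 4], [S2 ^+ 4] by [rho ^+ 4], or [O] by 1. *)
  have big t : 0 < t -> 1 <= t * W M w -> t <= 1 + dl ^- 4 + rho ^- 4 ->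
      `|est M w - p - D^-1 * S M w| <=
      e * `|S M w| + B' * (1 + dl ^- 4 + rho ^- 4) * W M w.
    move=> t0 tW tL; apply: (le_trans (res_bound M w)).
    apply: (@le_trans _ _ (B' * (1 + dl ^- 4 + rho ^- 4) * W M w)); last by rewrite lerDr.
    rewrite -[leLHS]mulr1 -mulrA ler_wpM2l// (le_trans tW)// ler_wpM2r//.
  have i1 : 0 <= dl ^- 4 by rewrite invr_ge0 ltW.
  have i2 : 0 <= rho ^- 4 by rewrite invr_ge0 ltW.
  have norm4 (u : R) : `|u| ^+ 4 = u ^+ 4.
    by rewrite !(exprM _ 2 2) real_normK ?num_real.
  have [hdlS|hdlS] := ltP dl `|S M w|.
    apply: (big (dl ^- 4)); [by rewrite invr_gt0| |lra].
    rewrite mulrC ler_pdivlMr// mul1r.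
    apply: (@le_trans _ _ (S M w ^+ 4)).
      by rewrite -(norm4 (S M w)) lerXn2r ?nnegrE// ltW.
    by rewrite /W -addrA lerDl addr_ge0.
  have [hS2|hS2] := ltP rho `|S2 M w|.
    apply: (big (rho ^- 4)); [by rewrite invr_gt0| |lra].
    rewrite mulrC ler_pdivlMr// mul1r.
    apply: (@le_trans _ _ (S2 M w ^+ 4)).
      by rewrite -(norm4 (S2 M w)) lerXn2r ?nnegrE// ltW.
    by rewrite /W (addrC (S M w ^+ 4)) -addrA lerDl addr_ge0.
  have [allin|] := pselect (forall k, (k < M)%N -> l <= X k w <= r); last first.
    move=> /existsNP[k /not_implyP[kM /negP knot]].
    apply: (big 1) => //; last by rewrite -addrA lerDl addr_ge0.
    rewrite mul1r; apply: (@le_trans _ _ (O M w)); last by rewrite /W lerDr addr_ge0.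
    rewrite /O (bigD1 (Ordinal kM))//= indicE mem_set/=.
      by rewrite lerDl sumr_ge0// => j _; rewrite indicE.
    by rewrite in_itv/=; exact/negP.
  have xbarE : sample_mean M (fun k => X k w) = m + S M w.
    rewrite /S -[m in RHS](sample_mean_cst M0) -sample_meanD.
    congr (_ * _); apply: eq_bigr => k _.
    by rewrite /h1 clip_id ?allin// subrKC.
  have conc : sample_mean M (fun k => (X k w - phi0) ^+ 2) <= (Delta / 48) ^+ 2.
    have -> : sample_mean M (fun k => (X k w - phi0) ^+ 2) = q + S2 M w.
      rewrite /S2 -[q in RHS](sample_mean_cst M0) -sample_meanD.
      congr (_ * _); apply: eq_bigr => k _.
      by rewrite /h2 clip_id ?allin// subrKC.
    by have := ler_norm (S2 M w); move: hS2; rewrite /rho; lra.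
  have := hdl (m + S M w); rewrite addrAC subrr add0r => /(_ hdlS)[x xE [xlin xphi]].
  have xlr : l <= x <= r by exact: itv_of_close inner_l inner_r Delta0 xphi.
  have -> : est M w = x.
    apply: (fmpe_unique s0 Delta0 inner_l inner_r lr outer_l outer_r M0 allin
      s_small conc (estP M w) xlr).
    by rewrite xE xbarE.
  apply: (le_trans xlin); rewrite lerDl mulr_ge0//.
  by rewrite mulr_ge0// !addr_ge0.
have hvar := delta_method_variance est_bound S_bm SB W_bm W_ge0 S_mean S_sqr hC linearized.
have hmean := delta_method_mean est_bound S_bm SB W_bm W_ge0 S_mean S_sqr hC linearized.
exists p, (D^-1 ^+ 2 * v); split => //.
- have vq := target_variance_le.
  have v0 : 0 <= v.
    by rewrite /v -(Eclip2 m 0); apply: Rintegral_ge0 => w _; exact: sqr_ge0.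
  apply: ler_pM => //; first exact: sqr_ge0.
    by rewrite lerXn2r ?nnegrE// invr_ge0 ltW.
  exact: le_trans vq qle.
- exact: hmean.
Qed.

End fmpe_asymptotics.

(* With [y = S ^+ 2 / 144], the bound [y ^+ 2 / 2 <= expR y] turns into
   [S ^+ 3 * expR (- y) <= width_threshold / (1152 * S)]. *)
Definition width_threshold (R : realType) : R := 2 * 144 ^+ 2 * 1152.

Lemma width_threshold_gt0 (R : realType) : 0 < width_threshold R.
Proof. rewrite /width_threshold; lra. Qed.

(** The exponent is split into two halves: the logarithmic condition makes one factor at most [lam],
    and the other absorbs the power of [S]. *)
Lemma leakage_small (R : realType) (S lam : R) : 0 < lam ->
  width_threshold R <= S -> 144 * ln lam^-1 <= S ^+ 2 ->
  S ^+ 3 * expR (- (S ^+ 2 / 72)) <= lam / 1152.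
Proof.
move=> lam0 NS hS; have S0 : 0 < S.
  exact: lt_le_trans (width_threshold_gt0 R) NS.
pose y := S ^+ 2 / 144.
have y0 : 0 <= y by rewrite divr_ge0// sqr_ge0.
have -> : - (S ^+ 2 / 72) = - y + - y by rewrite /y; field.
rewrite expRD.
have h1 : expR (- y) <= lam.
  rewrite -[leRHS]lnK ?posrE// ler_expR lerNl -lnV ?posrE//.
  by rewrite /y ler_pdivlMr// mulrC.
have e0 := expR_gt0 (- y).
have h2 : S ^+ 3 * expR (- y) <= 1152^-1.
  have ee : expR y * expR (- y) = 1 by rewrite expRxMexpNx_1.
  have ey : y ^+ 2 / 2 <= expR y.
    by have := expR_ge1Dxn 1 y0; rewrite (_ : 2`!%:R = 2 :> R)//; lra.
  have h3 : y ^+ 2 / 2 * expR (- y) <= 1 by rewrite -[leRHS]ee; apply: ler_wpM2r => //; exact: ltW.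
  rewrite -(ler_pM2r S0); apply: (@le_trans _ _ (2 * 144 ^+ 2)).
    rewrite (_ : S ^+ 3 * expR (- y) * S =
      2 * 144 ^+ 2 * (y ^+ 2 / 2 * expR (- y))); last by rewrite /y; field.
    by apply: ler_piMr => //; lra.
  by move: NS; rewrite /width_threshold; lra.
have S3 : 0 <= S ^+ 3 by rewrite exprn_ge0// ltW.
rewrite mulrA [leRHS]mulrC.
apply: (ler_pM _ _ h2 h1); last exact: ltW.
by apply: mulr_ge0 => //; exact: ltW.
Qed.

(** The constant has one summand per conclusion: 12 is the root of 144, and the other forces
    [Delta / s] above the threshold because the logarithm is at least [ln kappa^-1 > 0]. *)
Lemma fmpe_width (R : realType) (c2 kappa Delta eps eta s t : R) :
  0 < c2 -> 0 < kappa < 1 -> 0 < Delta -> 0 < eps -> eps <= kappa * Delta ->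
  0 < eta -> eta <= 1 -> 0 < s -> 0 < t -> s <= c2 / t ->
  c2 * (12 + width_threshold R / Num.sqrt (ln kappa^-1)) / Delta *
    Num.sqrt (ln (Delta / (eps * eta))) <= t ->
  width_threshold R <= Delta / s /\
  144 * ln (eps * eta / Delta)^-1 <= (Delta / s) ^+ 2.
Proof.
move=> c20 /andP[k0 k1] D0 e0 ekD eta0 eta1 s0 t0 st hK.
have N0 := width_threshold_gt0 R.
have lam0 : 0 < eps * eta by rewrite mulr_gt0.
rewrite invf_div; set L := ln (Delta / (eps * eta)) in hK *.
set l0 := ln kappa^-1 in hK *.
have l00 : 0 < l0 by rewrite ln_gt0// invf_gt1.
have lL : l0 <= L.
  rewrite ler_ln ?posrE ?invr_gt0 ?divr_gt0//.
  rewrite ler_pdivlMr// mulrC ler_pdivrMr//.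
  apply: (@le_trans _ _ (kappa * Delta * 1)); last by rewrite mulr1 mulrC.
  by apply: ler_pM => //; exact: ltW.
have L0 : 0 < L by exact: lt_le_trans lL.
have sl0 : 0 < Num.sqrt l0 by rewrite sqrtr_gt0.
have sL0 : 0 < Num.sqrt L by rewrite sqrtr_gt0.
have slL : Num.sqrt l0 <= Num.sqrt L by rewrite ler_sqrt// ltW.
have key : (12 + width_threshold R / Num.sqrt l0) * Num.sqrt L <= Delta / s.
  rewrite ler_pdivlMr//.
  apply: (@le_trans _ _ ((12 + width_threshold R / Num.sqrt l0) * Num.sqrt L * (c2 / t))).
    rewrite ler_wpM2l// mulr_ge0 ?ltW// addr_gt0// divr_gt0//.
  rewrite mulrA ler_pdivrMr// -ler_pdivrMl//; apply: le_trans hK.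
  by rewrite le_eqVlt; apply/orP; left; apply/eqP; field; rewrite !gt_eqF.
have N1 : 0 <= width_threshold R / Num.sqrt l0 * Num.sqrt L.
  by rewrite mulr_ge0 ?divr_ge0// ltW.
split.
  apply: le_trans key; rewrite mulrDl.
  apply: (@le_trans _ _ (width_threshold R / Num.sqrt l0 * Num.sqrt L)).
    by rewrite mulrAC ler_pdivlMr// ler_wpM2l// ltW.
  by rewrite lerDr mulr_ge0// ltW.
have -> : 144 * L = (12 * Num.sqrt L) ^+ 2.
  by rewrite exprMn sqr_sqrtr ?(ltW L0)//; ring.
have h12 : 12 * Num.sqrt L <= Delta / s.
  by apply: le_trans key; rewrite [leRHS]mulrDl lerDl.
by rewrite !expr2; apply: ler_pM => //; rewrite mulr_ge0// ltW.
Qed.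

(** * Leakage against the target precision *)

Section leakage_conditions.
Context (R : realType) (Delta s eps eta a0 : R).
Hypothesis Delta0 : 0 < Delta.
Hypothesis s0 : 0 < s.
Hypothesis eps0 : 0 < eps.
Hypothesis epsD : eps <= Delta.
Hypothesis eta0 : 0 < eta.
Hypothesis eta_a0 : eta <= a0.
Hypothesis wide : width_threshold R <= Delta / s.
Hypothesis leak :
  (Delta / s) ^+ 3 * expR (- ((Delta / s) ^+ 2 / 72)) <= eps * eta / Delta / 1152.
Notation lk := (Delta ^+ 2 * gaussian s (Delta / 6) / (a0 * s)).

Lemma width_small : s <= Delta / 480.
Proof.
have h : 480 <= width_threshold R by rewrite /width_threshold; lra.
have := le_trans h wide; rewrite (ler_pdivlMr _ _ s0) => hs.
lra.
Qed.

Let a00 : 0 < a0. Proof. exact: lt_le_trans eta0 eta_a0. Qed.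

Let S1 : 1 <= Delta / s.
Proof. by rewrite ler_pdivlMr// mul1r (le_trans width_small)//; move: Delta0 => ?; lra. Qed.

Let gE : gaussian s (Delta / 6) = expR (- ((Delta / s) ^+ 2 / 72)).
Proof. by rewrite /gaussian; congr expR; field; rewrite gt_eqF. Qed.

Let g0 : 0 < gaussian s (Delta / 6). Proof. exact: gaussian_gt0. Qed.

Let leak1 : Delta / s * gaussian s (Delta / 6) <= eps * eta / Delta / 1152.
Proof.
apply: le_trans leak; rewrite gE ler_wpM2r ?expR_ge0//.
by rewrite -[leLHS]expr1 ler_weXn2l.
Qed.

(** [1152 = 48 * 24], and the factor [eta] in [leak] compensates the division by [a0]. The first
    power of [Delta / s] is enough here; the second moment below uses the cube. *)
Lemma leakage_bias_le : 48 * lk <= eps / 24.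
Proof.
have -> : 48 * lk = 48 * Delta / a0 * (Delta / s * gaussian s (Delta / 6)).
  by field; rewrite !gt_eqF.
apply: (@le_trans _ _ (48 * Delta / a0 * (eps * eta / Delta / 1152))).
  by rewrite ler_wpM2l// divr_ge0 ?mulr_ge0// ltW.
have -> : 48 * Delta / a0 * (eps * eta / Delta / 1152) = eps / 24 * (eta / a0).
  by field; rewrite !gt_eqF.
rewrite ler_piMr//; first by rewrite divr_ge0// ltW.
by rewrite ler_pdivrMr// mul1r.
Qed.

Lemma leakage_second_moment_le :
  Delta ^+ 3 * gaussian s (Delta / 6) / (a0 * s) <= s ^+ 2.
Proof.
have -> : Delta ^+ 3 * gaussian s (Delta / 6) / (a0 * s) =
    s ^+ 2 * (((Delta / s) ^+ 3 * expR (- ((Delta / s) ^+ 2 / 72))) / a0).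
  by rewrite -gE; field; rewrite !gt_eqF.
rewrite ler_piMr ?sqr_ge0// ler_pdivrMr// mul1r; apply: (le_trans leak).
apply: (@le_trans _ _ eta); last exact: eta_a0.
have -> : eps * eta / Delta / 1152 = eta * (eps / Delta * 1152^-1).
  by field; rewrite gt_eqF.
have h : eps / Delta <= 1 by rewrite ler_pdivrMr// mul1r.
have h0 : 0 <= eps / Delta by apply: divr_ge0; exact: ltW.
apply: ler_piMr; [exact: ltW|lra].
Qed.

End leakage_conditions.

(** * Number of runs for a given precision *)

Section run_count.
Context (R : realType) (b V eps eta beta s c2 tt rho v0 C : R).
Hypothesis eps0 : 0 < eps.
Hypothesis eta0 : 0 < eta.
Hypothesis beta0 : 0 < beta.
Hypothesis t0 : 0 < tt.
Hypothesis s0 : 0 < s.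
Hypothesis st : s <= c2 / tt.
Hypothesis rho_ge : eta / 3 <= rho.
Hypothesis b_le : `|b| <= eps / 2.
Hypothesis v00 : 0 < v0.
Hypothesis V_le : V <= v0 * s ^+ 2.
Hypothesis CE : C = 6 * v0 * c2 ^+ 2.

Let rho0 : 0 < rho. Proof. by apply: lt_le_trans rho_ge; rewrite divr_gt0. Qed.

(** The squared bias takes [eps ^+ 2 / 4] and the variance [eps ^+ 2 / 2]. In [C], 6 is 2 for that
    half times 3 for [rho >= eta / 3]. *)
Lemma large_sample_rms_le M : (0 < M)%N ->
  C / (eta * tt ^+ 2 * eps ^+ 2) <= M%:R / rho ->
  large_sample_rms b V M <= eps.
Proof.
move=> M0; have MR : (0 : R) < M%:R by rewrite ltr0n.
rewrite ler_pdivlMr// mulrAC ler_pdivrMr ?mulr_gt0 ?exprn_gt0// => hM.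
rewrite /large_sample_rms -[leRHS]ger0_norm ?(ltW eps0)// -sqrtr_sqr.
rewrite ler_sqrt ?sqr_ge0//.
have b2 : b ^+ 2 <= eps ^+ 2 / 4.
  have -> : eps ^+ 2 / 4 = (eps / 2) ^+ 2 by field.
  rewrite -[leLHS]real_normK ?num_real// !expr2.
  by apply: ler_pM.
suff : V / M%:R <= eps ^+ 2 / 2 by move=> ?; have := sqr_ge0 eps; lra.
rewrite ler_pdivrMr//; apply: (le_trans V_le).
have s2 : s ^+ 2 <= c2 ^+ 2 / tt ^+ 2.
  by rewrite -expr_div_n !expr2; apply: ler_pM => //; exact: ltW.
apply: (@le_trans _ _ (v0 * (c2 ^+ 2 / tt ^+ 2))).
  by apply: ler_wpM2l => //; exact: ltW.
rewrite mulrA ler_pdivrMr ?exprn_gt0//.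
have C0 : 0 <= C by rewrite CE; apply: mulr_ge0; [rewrite mulr_ge0// ltW|exact: sqr_ge0].
have h : C * (eta / 3) <= C * rho by apply: ler_wpM2l.
have h2 : eta * (v0 * c2 ^+ 2) <= eta * (eps ^+ 2 / 2 * M%:R * tt ^+ 2).
  have e1 : C * (eta / 3) = 2 * (eta * (v0 * c2 ^+ 2)) by rewrite CE; field.
  have e2 : M%:R * (eta * tt ^+ 2 * eps ^+ 2) =
      2 * (eta * (eps ^+ 2 / 2 * M%:R * tt ^+ 2)) by field.
  by rewrite -(ler_pM2l (ltr0Sn R 1)) -e1 -e2 (le_trans h).
by move: h2; rewrite ler_pM2l.
Qed.

(** In [(1 + C) * q] the 1 pays for [beta / eta] and [C] for the precision. Rounding up costs at
    most [rho^-1 <= 3 / eta], which [beta / eta <= q] turns into [3 / beta * q]. *)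
Lemma sufficient_runs :
  beta / eta <= (eta * tt ^+ 2 * eps ^+ 2)^-1 ->
  exists M : nat,
  [/\ (0 < M)%N, beta / eta <= M%:R / rho,
      C / (eta * tt ^+ 2 * eps ^+ 2) <= M%:R / rho &
      M%:R / rho <= (1 + C + 3 / beta) / (eta * tt ^+ 2 * eps ^+ 2)].
Proof.
set q := (eta * tt ^+ 2 * eps ^+ 2)^-1 => bq.
have q0 : 0 < q by rewrite invr_gt0 !mulr_gt0 ?exprn_gt0.
have C0 : 0 <= C by rewrite CE; apply: mulr_ge0; [rewrite mulr_ge0// ltW|exact: sqr_ge0].
have B0 : 0 <= (1 + C) * q * rho.
  by rewrite !mulr_ge0 ?(ltW q0) ?(ltW rho0)// addr_ge0.
have /andP[h1 h2] := truncn_itv B0.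
set M := Num.truncn _ in h1 h2.
exists M.+1.
have lb : (1 + C) * q <= M.+1%:R / rho by rewrite ler_pdivlMr// ltW.
have ub : M.+1%:R / rho <= (1 + C) * q + rho^-1.
  rewrite ler_pdivrMr// mulrDl mulVf ?gt_eqF// -natr1.
  by rewrite lerD2r.
have Cq : 0 <= C * q by rewrite mulr_ge0// ltW.
have ri : rho^-1 <= 3 / beta * q.
  have r1 : rho^-1 <= 3 / eta.
    by rewrite -[3 / eta]invf_div lef_pV2 ?posrE// divr_gt0.
  apply: (le_trans r1).
  have -> : 3 / eta = 3 / beta * (beta / eta) by field; rewrite !gt_eqF.
  by apply: ler_wpM2l => //; rewrite divr_ge0// ltW.
split => //.
- by apply: (le_trans bq); apply: le_trans lb; lra.
- by apply: le_trans lb; rewrite mulrDl mul1r lerDr ltW.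
- by apply: (le_trans ub); rewrite !mulrDl; rewrite mulrDl in ri *; lra.
Qed.

End run_count.

(* c1, c2: constants of sigma = Theta(1/t); beta: constant of M' = Omega(1/eta);
   kappa: the target error eps is at most kappa * Delta, so that the logarithm
   in the condition on t stays away from 0.
   K: constant of the condition on t; C, C': constants of the O bounds. *)
Theorem theorem28 (R : realType) (c1 c2 beta kappa : R)
    (hc1 : 0 < c1) (hc2 : 0 < c2) (hbeta : 0 < beta) (hkappa : 0 < kappa < 1) :
  exists K C C' : R, [/\ 0 < K, 0 < C, 0 < C' &
  forall (n : nat) (U : 'M[R[i]]_n.+1) (v : 'I_n.+1 -> 'cV[R[i]]_n.+1)
    (phi : 'I_n.+1 -> R) (psi : 'cV[R[i]]_n.+1)
    (Delta eta guess eps sigma : R) (t : nat)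
    (d : measure_display) (T : measurableType d) (Pr : probability T R)
    (X est : nat -> {RV Pr >-> R}),
  let phi0 := phi ord0 in
  let a := overlap v psi in
  let D := window guess Delta in
  let runs := expected_runs a phi sigma D in
  let calls := total_calls a phi sigma D t in
  U \is unitarymx ->
  eigendecomposition U v phi ->
  braket psi psi = 1 ->
  (* spectral gap; the phases are shifted so that [phi0 - Delta, phi0 + Delta],
     which contains D, does not wrap around the circle *)
  0 < Delta ->
  (forall j, j != ord0 -> Delta < `|phi j - phi0|) ->
  0 <= phi0 - Delta -> phi0 + Delta < 2 * pi ->
  (* initial state and initial guess *)
  0 < eta -> eta < a ord0 ->
  `|phi0 - guess| < Delta / 3 ->
  (* t calls per circuit, kernel width Theta(1/t) *)
  (0 < t)%N ->
  c1 / t%:R <= sigma -> sigma <= c2 / t%:R ->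
  (* the retained samples are independent with density P on D, and est M is the
     FMPE computed from the first M of them *)
  mutually_independent X ->
  (forall k, has_density_on (X k) D (filtered_density a phi sigma D)) ->
  (forall M w, is_fmpe sigma D M (fun k => X k w) (est M w)) ->
  0 < eps -> eps <= kappa * Delta ->
  K / Delta * Num.sqrt (ln (Delta / (eps * eta))) <= t%:R ->
  exists b V : R,
  [/\ asymptotic_bias est phi0 b,
      asymptotic_variance est V,
      (* M' = Omega(1/eta) and M' at least C / (eta t^2 eps^2) suffice *)
      forall M : nat, (0 < M)%N ->
        beta / eta <= runs M ->
        C / (eta * t%:R ^+ 2 * eps ^+ 2) <= runs M ->
        large_sample_rms b V M <= eps
    & (* and that many runs cost O(1 / (eta t eps^2)) calls *)
      beta / eta <= (eta * t%:R ^+ 2 * eps ^+ 2)^-1 ->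
      exists M : nat,
        [/\ (0 < M)%N,
            beta / eta <= runs M,
            runs M <= C' / (eta * t%:R ^+ 2 * eps ^+ 2),
            calls M <= C' / (eta * t%:R * eps ^+ 2)
          & large_sample_rms b V M <= eps]]].
Proof.
pose K : R := c2 * (12 + width_threshold R / Num.sqrt (ln kappa^-1)).
(* Squared inverse slope bound times the second-moment constant [16 + 1], the 1 being the share of
   the leakage. *)
pose v0 : R := 48 ^+ 2 * 17.
pose C : R := 6 * v0 * c2 ^+ 2.
have v00 : 0 < v0 by rewrite /v0; lra.
have C0 : 0 < C by apply: mulr_gt0; [exact: mulr_gt0|exact: exprn_gt0].
have K0 : 0 < K.
  apply: mulr_gt0 => //; apply: ltr_wpDr => //.
  by apply: divr_ge0; [exact: ltW (width_threshold_gt0 R)|exact: sqrtr_ge0].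
exists K, C, (1 + C + 3 / beta); split => //.
  by apply: addr_gt0; [exact: addr_gt0|exact: divr_gt0].
move=> n U v phi psi Delta eta guess eps sigma t d T Pr X est phi0 a D runs calls.
move=> _ [vv _ phi_itv] psi1 Delta0 gap outer_l outer_r eta0 eta_a0 near t0 sig1 sig2.
move=> indX densX estP eps0 eps_le t_large.
have tR : (0 : R) < t%:R by rewrite ltr0n.
have s0 : 0 < sigma by apply: lt_le_trans sig1; exact: divr_gt0.
have a_ge0 j : 0 <= a j by exact: overlap_ge0.
have a_sum1 : \sum_j a j = 1 by exact: sum_overlap.
have a_sum : \sum_j a j <= 1 by rewrite a_sum1.
have a0_le1 : a ord0 <= 1.
  by rewrite -a_sum1 (bigD1 ord0)//= lerDl sumr_ge0.
have a0_gt0 : 0 < a ord0 by exact: lt_trans eta_a0.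
have eta1 : eta <= 1 by rewrite (le_trans (ltW eta_a0)).
have eps_Delta : eps <= Delta.
  apply: (le_trans eps_le); have /andP[_ k1] := hkappa.
  by rewrite ler_piMl// ltW.
have [wide lnS] := fmpe_width hc2 hkappa Delta0 eps0 eps_le eta0 eta1 s0 tR sig2 t_large.
have lam0 : 0 < eps * eta / Delta by rewrite divr_gt0// mulr_gt0.
have leak := leakage_small lam0 wide lnS.
have ss := width_small s0 wide.
have bias := leakage_bias_le Delta0 s0 eps0 eta0 (ltW eta_a0) wide leak.
have moment := leakage_second_moment_le Delta0 s0 eps0 eps_Delta eta0 (ltW eta_a0) leak.
have eD24 : eps / 24 <= Delta / 24 by apply: ler_wpM2r.
have bias' := le_trans bias eD24.
move: near; rewrite ltr_norml => /andP[near1 near2].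
have inner_l : guess - Delta / 2 <= phi ord0 - Delta / 6.
  by move: near1; rewrite -/phi0; lra.
have inner_r : phi ord0 + Delta / 6 <= guess + Delta / 2.
  by move: near2; rewrite -/phi0; lra.
have lr : guess + Delta / 2 - (guess - Delta / 2) = Delta by field.
have gap' j : j != ord0 -> phi j < phi ord0 - Delta \/ phi ord0 + Delta < phi j.
  move=> /gap; rewrite lter_normr => /orP[h|h].
    by right; rewrite addrC -ltrBrDr.
  by left; rewrite ltrBrDr addrC -ltrBrDr -opprB.
have s6 : sigma <= Delta / 6 by move: ss Delta0; clear; lra.
have retained := retained_fraction_ge s0 a_ge0 a_sum phi_itv Delta0 gap' inner_l
  inner_r lr outer_l outer_r s6.
have [p [V [p_close V_le hb hV]]] := fmpe_asymptotics s0 a_ge0 a_sum phi_itv Delta0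
  gap' inner_l inner_r lr outer_l outer_r ss a0_gt0 indX densX estP moment bias'.
exists (p - phi ord0), V.
have rho_ge : eta / 3 <= retained_fraction a phi sigma D.
  by apply: le_trans retained; apply: ler_wpM2r => //; exact: ltW.
have b_le : `|p - phi ord0| <= eps / 2.
  by apply: (le_trans p_close); apply: (le_trans bias); lra.
have V_le' : V <= v0 * sigma ^+ 2 by rewrite /v0 -mulrA.
have rms M M0 h := large_sample_rms_le (M := M) eps0 eta0 tR s0 sig2 rho_ge b_le
  v00 V_le' erefl M0 h.
split => //; first by move=> M M0 _ hM; exact: rms.
move=> enough.
have [M [M0 hM1 hM2 hM3]] := sufficient_runs eps0 eta0 hbeta tR rho_ge v00 (erefl C) enough.
exists M; split => //; last exact: rms.
rewrite /calls /total_calls -/(runs M).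
apply: (le_trans (ler_wpM2l (ltW tR) hM3)).
by rewrite le_eqVlt; apply/orP; left; apply/eqP; field; rewrite !gt_eqF.
Qed.
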